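(* Let $p_2\in(1,2]$. For every $\delta>0$ there exists a weight $w$ on $\mathbb{R}$ such that $w-1\in L^{p_2}(\mathbb{R})$, $[w]_{A_2(\mathbb{R})}\le1+\delta$, and $$\sup_{r\ge0}\left\|P(r,\lambda;w)-e^{i\lambda r}\right\|_{L^p_w(\mathbb{R})}=\infty$$ for every $p\in[1,p_2)$.
   Context: A weight is a measurable function $w\ge0$ on $\mathbb{R}$. $L^p_w(\mathbb{R})$ denotes $L^p(\mathbb{R},w(\lambda)\,d\lambda)$, in the variable $\lambda$; the norm is $\infty$ if the function is not in the space. $[w]_{A_2(\mathbb{R})}=\sup_I\langle w\rangle_I\langle w^{-1}\rangle_I$, where $I$ ranges over finite intervals and $\langle f\rangle_I=\frac1{|I|}\int_If$. Krein system solution $P(r,\lambda;w)$: let $w\ge 0$ with $w-1\in L^1(\mathbb{R})+L^2(\mathbb{R})$ (this contains $L^{p_2}$ for $p_2\in[1,2]$). Put $H(x)=\frac1{2\pi}\int_{\mathbb{R}}(w(\lambda)-1)e^{i\lambda x}\,d\lambda$ (Fourier transform in the $L^1+L^2$ sense), so $H\in L^2_{loc}(\mathbb{R})$. For $r>0$ define $\mathcal{H}_r$ on $L^2([0,r])$ by $\mathcal{H}_rf(x)=\int_0^rH(x-y)f(y)\,dy$; then $I+\mathcal{H}_r>0$ is boundedly invertible, and $I-(I+\mathcal{H}_r)^{-1}$ is an integral operator with kernel $\Gamma_r(s,t)$, $0\le s,t\le r$, satisfying $\Gamma_r(s,t)=\overline{\Gamma_r(t,s)}=\Gamma_r(r-t,r-s)$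 and $\Gamma_r(\cdot,0)=(I+\mathcal{H}_r)^{-1}(H|_{[0,r]})$. Then, for $r>0$, $P(r,\lambda;w)=e^{i\lambda r}-\int_0^r\Gamma_r(r,t)e^{i\lambda t}\,dt$ with $\Gamma_r(r,t)=\Gamma_r(r-t,0)$, and $P(0,\lambda;w)=1$. *)

(* Defs.v *)
From HB Require Import structures.
From mathcomp Require Import all_boot all_order all_algebra.
From mathcomp Require Import all_classical all_reals all_analysis.
From mathcomp Require Import complex.

Set Implicit Arguments.
Unset Strict Implicit.
Unset Printing Implicit Defensive.

Import Order.TTheory GRing.Theory Num.Theory.
Import numFieldNormedType.Exports.

Local Open Scope classical_set_scope.
Local Open Scope ring_scope.
Local Open Scope complex_scope.

(* The library has no norm topology, measurability or integral for [R[i]];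
   these notions are taken componentwise. *)
Section complex_functions.
Context {R : realType}.
Notation mu := (@lebesgue_measure R).

Definition expi (x : R) : R[i] := cos x +i* sin x.

(* The modulus as an element of [R] (the library's [`|z|] lives in [R[i]]). *)
Definition cabs (z : R[i]) : R := ComplexField.Normc.normc z.

Definition cmeasurable_fun (D : set R) (f : R -> R[i]) : Prop :=
  measurable_fun D (fun x => complex.Re (f x)) /\
  measurable_fun D (fun x => complex.Im (f x)).

Definition cintegral (D : set R) (f : R -> R[i]) : R[i] :=
  (\int[mu]_(x in D) complex.Re (f x)) +i* (\int[mu]_(x in D) complex.Im (f x)).

(* [L^2(D)], on functions rather than on classes. *)
Definition cL2 (D : set R) : set (R -> R[i]) :=
  [set f | cmeasurable_fun D f /\
           (\int[mu]_(x in D) ((cabs (f x)) ^+ 2)%:E < +oo)%E].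

End complex_functions.

Section weights.
Context {R : realType}.
Notation mu := (@lebesgue_measure R).

Definition weight (w : R -> R) : Prop :=
  measurable_fun setT w /\ forall x, 0 <= w x.

Definition average (I : set R) (f : R -> \bar R) : \bar R :=
  ((mu I)^-1 * \int[mu]_(x in I) f x)%E.

(* [w^-1] is taken in [\bar R], so that it is [+oo] where [w] vanishes.  The
   convention [0 * +oo = 0] matters only on intervals where [w = 0] a.e.; unless
   [w = 0] a.e. on the line, a larger interval then gives the value [+oo]. *)
Definition A2_const (w : R -> R) : \bar R :=
  ereal_sup [set c | exists a b : R, a < b /\
    c = (average `[a, b] (fun x => (w x)%:E) *
         average `[a, b] (fun x => ((w x)%:E)^-1))%E].

(* Norm in [L^p(R, w(x) dx)]; it is [+oo] outside of the space. *)
Definition wLnorm (w : R -> R) (p : R) (f : R -> R[i]) : \bar R :=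
  ((\int[mu]_x ((cabs (f x)) `^ p * w x)%:E) `^ (p^-1))%E.

End weights.

Section fourier.
Context {R : realType}.
Notation mu := (@lebesgue_measure R).

(* [1/(2 pi) * int f(l) e^{i l x} dl], for integrable [f]. *)
Definition fourierL1 (f : R -> R) (x : R) : R[i] :=
  ((2 * pi)^-1)%:C * cintegral setT (fun l => (f l)%:C * expi (l * x)).

(* [F] is the [L^2] transform of [f]: limit in [L^2] of the transforms of the
   truncations of [f] to [[-n, n]]. *)
Definition is_fourierL2 (f : R -> R) (F : R -> R[i]) : Prop :=
  cmeasurable_fun setT F /\
  (fun n : nat => \int[mu]_x
     ((cabs (F x - fourierL1 (f \* \1_(`[- n%:R, n%:R])) x)) ^+ 2)%:E)%E
    @ \oo --> 0%E.

(* [F] is the transform of [f] in [L^1 + L^2], determined up to a null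
   set.  As [f] is real-valued, the two summands may be taken real-valued. *)
Definition is_fourier (f : R -> R) (F : R -> R[i]) : Prop :=
  exists (f1 f2 : R -> R) (F2 : R -> R[i]),
    [/\ f1 \in Lfun mu 1%:E, f2 \in Lfun mu 2%:E, f = f1 \+ f2,
        is_fourierL2 f2 F2
      & F = (fun x => fourierL1 f1 x + F2 x)].

Definition fourier (f : R -> R) : R -> R[i] :=
  xget (fun=> 0) [set F | is_fourier f F].

End fourier.

Section krein.
Context {R : realType}.
Notation mu := (@lebesgue_measure R).
Implicit Types (w : R -> R) (r s t x lambda : R) (f g h : R -> R[i]).

Definition kreinH w : R -> R[i] := fourier (fun l => w l - 1).

Definition kreinHop w r f x : R[i] :=
  cintegral `[0, r] (fun y => kreinH w (x - y) * f y).

(* A representative of [(I + H_r)^-1 h] in [L^2([0, r])]. *)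
Definition kreinInv w r h : R -> R[i] :=
  xget (fun=> 0) [set g | cL2 `[0, r] g /\
    {ae mu, forall x, `[0, r]%classic x -> g x + kreinHop w r g x = h x}].

(* [I - (I + H_r)^-1 = (I + H_r)^-1 H_r] and the kernel of [H_r] is [H(s - t)],
   so the column [Gamma_r(., t)] is [(I + H_r)^-1 H(. - t)].  For each [t] it is
   determined up to a null set in the first variable. *)
Definition kreinGamma w r s t : R[i] :=
  kreinInv w r (fun x => kreinH w (x - t)) s.

(* [Gamma_r(r, t)] is read as [Gamma_r(r - t, 0)]. *)
Definition kreinP w r lambda : R[i] :=
  if 0 < r then
    expi (lambda * r) -
    cintegral `[0, r] (fun t => kreinGamma w r (r - t) 0 * expi (lambda * t))
  else 1.

End krein.

(* Main.v *)
(** The weight is [w = 1 + sum_k d_k 1_[L_k, L_k + N_k](|l|)]: very long blocks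
    ([N_k] large) of very small height [d_k], with [d_k^p2 N_k] summable but
    [d_k^p N_k] unbounded for every [p < p2], placed very far apart.  Since
    [1 <= w <= 1 + d_0], the [A_2] constant is at most [1 + d_0].

    For [r] small, [H] has small [L^1] norm on [[-r, r]], so that
    [Gamma_r(., 0) = H - H * Gamma_r(., 0)] is close to [H].  Take [r = 1 / N_k]
    and [lambda] in the [k]-th block.  There [H] oscillates at frequency
    [lambda] up to a phase shift of at most one radian on [[0, r]], so the
    cosine transform of [H] over [[0, r]] at [lambda] is of order [d_k]: the
    other blocks are too far from [lambda] to contribute.  The same
    computation bounds the cosine transform of every translate [H(. - y)] by a
    multiple of [d_k], so the correction [H * Gamma_r(., 0)] only costs a
    fraction of [d_k].  Hence [|P(r, lambda) - e^(i lambda r)| >= c d_k] on the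
    block, and the norm is at least [c d_k N_k^(1/p)], which tends to infinity. *)

From HB Require Import structures.
Require Import Defs.
From mathcomp Require Import all_boot all_order all_algebra.
From mathcomp Require Import all_classical all_reals all_analysis.
From mathcomp Require Import complex.
From mathcomp Require Import measurable_realfun.
From mathcomp Require Import ring lra.

Set Implicit Arguments.
Unset Strict Implicit.
Unset Printing Implicit Defensive.

Import Order.TTheory GRing.Theory Num.Theory.
Import numFieldNormedType.Exports.

Local Open Scope classical_set_scope.
Local Open Scope ring_scope.

(** * Convolution on the line and small convolution equations *)
Section reflection.
Context {R : realType}.
Notation mu := (@lebesgue_measure R).

(** The difficulty is one of scale. The L^1 norm of [H] near 0 is only a small fixed fraction, while
    the main term d_k tends to 0, so no norm estimate of [H * Gamma] can be compared with it. The
    correction is therefore tested against the cosine first: Fubini turns it into cosine transforms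
    of translates of [H], already of order d_k, averaged against [Gamma], and only then does the
    small L^1 norm of [Gamma] enter. The choice r = 1 / N_k balances two demands: a longer interval
    lets the phases inside the block spread beyond one radian, a shorter one collects less than d_k
    N_k r = d_k. Since N_k tends to infinity, r tends to 0, and the smallness of [H] on [-r, r] is
    automatic for large k. The transform [H] is known only up to a null set, through an unspecified
    L^1 + L^2 splitting. Estimates are thus proved for the transforms of the truncations of [w - 1],
    which are explicit finite sums, and carried to the limit under one integrable majorant of their
    squares. *)

Lemma measurable_subl (c : R) :
  measurable_fun [set: measurableTypeR R] (fun y : R => c - y : measurableTypeR R).
Proof. by apply: measurable_funB. Qed.

(** The pushforward is a measure that gives half-open intervals their length, since the preimage of
    []a, b]] is [[c - b, c - a[]; uniqueness of Lebesgue measure concludes. *)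
Lemma lebesgue_measure_reflect (c : R) (A : set (measurableTypeR R)) :
  measurable A -> pushforward mu (fun y : measurableTypeR R => (c - y) : measurableTypeR R) A = mu A.
Proof.
move=> mA.
pose nu := [the {measure set (measurableTypeR R) -> \bar R} of
  pushforward mu (fun y : measurableTypeR R => (c - y) : measurableTypeR R)].
apply/esym; refine (@lebesgue_measure_unique _ (nu (measurable_subl c)) _ A mA).
move=> _ [[a b]] _ <-.
rewrite /nu /=.
rewrite /pushforward.
rewrite (_ : _ @^-1` _ = `[c - b, c - a[%classic); last first.
  by apply/seteqP; split => x /=; rewrite !in_itv/= => /andP[? ?]; apply/andP; split; lra.
rewrite !lebesgue_measure_itv/= !lte_fin ltrD2l ltrN2 //.
by case: ifPn => // _; congr (_%:E); lra.
Qed.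

Lemma integral_reflect (c : R) (F : R -> \bar R) : measurable_fun setT F ->
  (\int[mu]_y F (c - y)%R = \int[mu]_y F y)%E.
Proof.
move=> mF; rewrite integralE [RHS]integralE.
have H (G : R -> \bar R) : measurable_fun setT G -> (forall x, 0 <= G x)%E ->
    (\int[mu]_y G (c - y)%R = \int[mu]_y G y)%E.
  move=> mG G0.
  transitivity (\int[pushforward mu (fun y : measurableTypeR R => (c - y)%R : measurableTypeR R)]_y G y)%E.
    by rewrite ge0_integral_pushforward//; exact: measurable_subl.
  apply: eq_measure_integral; first exact: measurable_subl.
  by move=> ? A mA _; exact: lebesgue_measure_reflect.
congr (_ - _)%E.
  by rewrite -[RHS]H//; [rewrite [funepos]unlock|exact: measurable_funepos].
by rewrite -[RHS]H//; [rewrite [funeneg]unlock|exact: measurable_funeneg].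
Qed.

Lemma Rintegral_reflect (c : R) (F : R -> R) : measurable_fun setT F ->
  \int[mu]_y F (c - y) = \int[mu]_y F y.
Proof.
move=> mF; rewrite /Rintegral; congr fine.
by apply: (@integral_reflect c (EFin \o F)); exact/measurable_EFinP.
Qed.

Lemma integrable_reflect (c : R) (F : R -> R) :
  mu.-integrable setT (EFin \o F) ->
  mu.-integrable setT (EFin \o (fun y => F (c - y))).
Proof.
move=> /integrableP[mF iF]; apply/integrableP; split.
  by apply: (measurableT_comp mF); exact: measurable_subl.
have := @integral_reflect c (fun y => `|(F y)%:E|%E).
by move=> /= -> //; exact: (measurableT_comp (@abse_measurable _ _) mF).
Qed.

Lemma ae_reflect (c : R) (P : R -> Prop) :
  {ae mu, forall x, P x} -> {ae mu, forall y, P (c - y)}.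
Proof.
move=> [N [mN N0 sN]]; exists ((fun y => c - y) @^-1` N); split.
- by rewrite -[X in measurable X]setTI; exact: measurable_subl.
- by rewrite -[RHS]N0 -[RHS](lebesgue_measure_reflect c mN).
- by move=> y /= nP; apply: sN.
Qed.

End reflection.

Section convolution.
Context {R : realType}.
Notation mu := (@lebesgue_measure R).
Implicit Types K v b h : R -> R.

(** A translation is the composition of the reflections [y => 0 - y] and [y => c - y]. *)
Lemma integral_translate (c : R) (F : R -> \bar R) : measurable_fun setT F ->
  (\int[mu]_y F (y - c)%R = \int[mu]_y F y)%E.
Proof.
move=> mF.
have mF' : measurable_fun setT (fun y : R => F (0 - y)%R).
  by apply: (measurableT_comp mF); exact: measurable_subl.
rewrite -[RHS](@integral_reflect _ 0)// -(@integral_reflect _ c (fun y : R => F (0 - y)%R))//.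
by apply: eq_integral => y _; congr F; lra.
Qed.

(** When the integral is infinite, its real version is 0 by default and the bound is trivial. *)
Lemma abs_Rintegral_le (D : set R) (f : R -> R) : measurable D -> measurable_fun D f ->
  (`|\int[mu]_(x in D) f x|%:E <= \int[mu]_(x in D) `|(f x)%:E|)%E.
Proof.
move=> mD mf; apply: (le_trans _ (le_abse_integral mu mD _)); last exact/measurable_EFinP.
by rewrite /Rintegral; case: (\int[mu]_(x in D) (f x)%:E)%E => [r||] /=; rewrite ?normr0 ?lee_fin ?leey.
Qed.

Lemma integrable_measurable (D : set R) (f : R -> R) :
  mu.-integrable D (EFin \o f) -> measurable_fun D f.
Proof. by move=> /integrableP[/measurable_EFinP]. Qed.

Lemma Rintegral_EFin (D : set R) (f : R -> R) : measurable D ->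
  mu.-integrable D (EFin \o f) ->
  (\int[mu]_(x in D) f x)%:E = (\int[mu]_(x in D) (f x)%:E)%E.
Proof. by move=> mD fi; rewrite /Rintegral fineK//; exact: integrable_fin_num. Qed.

Definition conv K v x : R := \int[mu]_y (K (x - y) * v y).

Lemma measurable_conv_prod K v : measurable_fun setT K -> measurable_fun setT v ->
  measurable_fun setT (fun z : R * R => K (z.1 - z.2) * v z.2).
Proof.
move=> mK mv; apply: measurable_funM; last by apply: (measurableT_comp mv).
by apply: (measurableT_comp mK); apply: measurable_funB.
Qed.

Lemma integral_abs_conv_prod K v : measurable_fun setT K -> measurable_fun setT v ->
  (\int[mu]_y \int[mu]_x `|(K (x - y) * v y)%:E| =
   (\int[mu]_x `|(K x)%:E|) * \int[mu]_y `|(v y)%:E|)%E.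
Proof.
move=> mK mv.
have mK' : measurable_fun setT (fun x => `|(K x)%:E|%E).
  by apply: measurableT_comp => //; exact/measurable_EFinP.
have mv' : measurable_fun setT (fun x => `|(v x)%:E|%E).
  by apply: measurableT_comp => //; exact/measurable_EFinP.
rewrite -ge0_integralZl//; last by apply: integral_ge0 => ? _.
apply: eq_integral => y _.
rewrite -(@integral_translate y (fun x => `|(K x)%:E|%E))// -ge0_integralZr//.
- by apply: eq_integral => x _; rewrite EFinM abseM.
- by apply: (measurableT_comp mK'); apply: measurable_funB.
Qed.

Lemma conv_prod_integrable K v :
  mu.-integrable setT (EFin \o K) -> mu.-integrable setT (EFin \o v) ->
  (mu \x mu)%E.-integrable setT (fun z : R * R => (K (z.1 - z.2) * v z.2)%:E).
Proof.
move=> /integrableP[mK iK] /integrableP[mv iv].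
have m := measurable_conv_prod ((measurable_EFinP _ _).1 mK) ((measurable_EFinP _ _).1 mv).
apply/integrable21ltyP; first exact/measurable_EFinP.
rewrite /= integral_abs_conv_prod; [|exact/measurable_EFinP|exact/measurable_EFinP].
by rewrite lte_mul_pinfty// ?ge0_fin_numE// integral_ge0.
Qed.

Lemma measurable_conv K v :
  mu.-integrable setT (EFin \o K) -> mu.-integrable setT (EFin \o v) ->
  measurable_fun setT (conv K v).
Proof.
move=> iK iv; have := measurable_fubini_F (conv_prod_integrable iK iv).
by move=> m; apply: (measurableT_comp (fine_measurable measurableT) m).
Qed.

(** Young's inequality in L^1, by Tonelli. Where the inner integral is infinite, [conv] is 0 by
    default, which respects the pointwise bound. *)
Lemma integral_abs_conv_le K v :
  mu.-integrable setT (EFin \o K) -> mu.-integrable setT (EFin \o v) ->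
  (\int[mu]_x `|(conv K v x)%:E| <=
   (\int[mu]_x `|(K x)%:E|) * \int[mu]_x `|(v x)%:E|)%E.
Proof.
move=> iK iv.
have mK := integrable_measurable iK; have mv := integrable_measurable iv.
have m := measurable_conv_prod mK mv.
rewrite -integral_abs_conv_prod//.
have /= <- := @fubini_tonelli _ _ _ _ R mu mu (fun z : R * R => `|(K (z.1 - z.2) * v z.2)%:E|)%E; last 2 first.
- by apply/measurable_EFinP; exact: measurableT_comp.
- by move=> ?.
apply: ge0_le_integral => //.
- by apply/measurable_EFinP; apply: measurableT_comp => //; exact: measurable_conv.
- refine (@measurable_fun_fubini_tonelli_F _ _ _ _ R mu (fun z : R * R => `|(K (z.1 - z.2) * v z.2)%:E|)%E _ _) => //.
  by apply/measurable_EFinP; exact: measurableT_comp.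
- move=> x _; apply: abs_Rintegral_le => //.
  exact: (measurableT_comp m (measurable_pair1 x)).
Qed.

Lemma integrable_conv K v :
  mu.-integrable setT (EFin \o K) -> mu.-integrable setT (EFin \o v) ->
  mu.-integrable setT (EFin \o conv K v).
Proof.
move=> iK iv; apply/integrableP; split.
  by apply/measurable_EFinP; exact: measurable_conv.
apply: le_lt_trans (integral_abs_conv_le iK iv) _.
have [_ iK'] := integrableP _ _ _ iK; have [_ iv'] := integrableP _ _ _ iv.
by rewrite lte_mul_pinfty// ?ge0_fin_numE// integral_ge0.
Qed.

Lemma integral_abs_conv K v :
  mu.-integrable setT (EFin \o K) -> mu.-integrable setT (EFin \o v) ->
  \int[mu]_x `|conv K v x| <= (\int[mu]_x `|K x|) * (\int[mu]_x `|v x|).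
Proof.
move=> iK iv; rewrite -lee_fin EFinM !Rintegral_EFin//.
- exact: integral_abs_conv_le.
- exact: integrable_norm.
- exact: integrable_norm.
- by apply: integrable_norm; exact: integrable_conv.
Qed.

Lemma integrable_mul_bounded (f b : R -> R) (M : R) :
  mu.-integrable setT (EFin \o f) -> measurable_fun setT b ->
  (forall x, `|b x| <= M) -> mu.-integrable setT (EFin \o (fun x => f x * b x)).
Proof.
move=> fi mb bM.
have fiM : mu.-integrable setT (fun x => (M%:E * (f x)%:E)%E) by exact: integrableZl.
apply: le_integrable fiM => //.
  by apply/measurable_EFinP; apply: measurable_funM => //; exact: integrable_measurable.
move=> x _; rewrite /= lee_fin normrM [leRHS]normrM mulrC ler_wpM2r//.
by rewrite (le_trans (bM x))// ler_norm.
Qed.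

Lemma integrable_conv_bounded K b (M : R) x :
  mu.-integrable setT (EFin \o K) -> measurable_fun setT b ->
  (forall x, `|b x| <= M) -> mu.-integrable setT (EFin \o (fun y => K (x - y) * b y)).
Proof. by move=> iK; apply: integrable_mul_bounded; exact: integrable_reflect. Qed.

Lemma conv_bounded K b (M : R) x :
  mu.-integrable setT (EFin \o K) -> measurable_fun setT b ->
  (forall x, `|b x| <= M) -> `|conv K b x| <= (\int[mu]_x `|K x|) * M.
Proof.
move=> iK mb bM.
have mK := integrable_measurable iK.
apply: le_trans (le_normr_Rintegral _ _) _ => //; first exact: (integrable_conv_bounded _ iK mb bM).
rewrite -(@Rintegral_reflect _ x (fun y => `|K y|)); last exact: measurableT_comp.
have iKx : mu.-integrable setT (EFin \o (fun y => `|K (x - y)|)).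
  exact: (integrable_norm (integrable_reflect x iK)).
rewrite -RintegralZr//; apply: le_Rintegral => //.
- by apply: integrable_norm; exact: (integrable_conv_bounded _ iK mb bM).
- by apply: (integrable_mul_bounded (M := `|M|)) => //; apply: measurable_cst.
- by move=> y _; rewrite normrM ler_wpM2l.
Qed.

End convolution.

Section integral_equation.
Context {R : realType}.
Notation mu := (@lebesgue_measure R).
Implicit Types K v b h : R -> R.

Lemma ae_imp (P Q : R -> Prop) : {ae mu, forall x, P x} ->
  (forall x, P x -> Q x) -> {ae mu, forall x, Q x}.
Proof.
move=> [N [mN N0 sN]] PQ; exists N; split=> // x nQ.
by apply: sN => Px; exact/nQ/PQ.
Qed.

Lemma ae_and (P Q : R -> Prop) : {ae mu, forall x, P x} -> {ae mu, forall x, Q x} ->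
  {ae mu, forall x, P x /\ Q x}.
Proof.
move=> P0 Q0; have := negligibleU P0 Q0; apply: negligibleS => x /= nPQ.
by apply/not_andP => -[? ?]; exact: nPQ.
Qed.

Lemma cvg_of_tail_bound (u e : nat -> R) :
  (forall n m, (n <= m)%N -> `|u m - u n| <= e n) -> e @ \oo --> 0 ->
  cvgn u /\ forall n, `|limn u - u n| <= e n.
Proof.
move=> ue e0.
have cu : cvgn u.
  apply/cauchy_cvgP/cauchy_exP => eps eps0.
  have /cvgrPdist_lt /(_ _ eps0) [N _ HN] := e0.
  exists (u N); exists N => // m /= Nm.
  rewrite /ball /= distrC (le_lt_trans (ue _ _ Nm))//.
  have := HN N (leqnn N); rewrite sub0r normrN; exact/le_lt_trans/ler_norm.
split=> // n.
have H : (fun m => `|u m - u n|) @ \oo --> `|limn u - u n|.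
  by apply: cvg_norm; apply: cvgB => //; exact: cvg_cst.
rewrite -(cvg_lim _ H)//; apply: limr_le.
  by apply/cvg_ex; eexists; exact: H.
by exists n => // m /= nm; exact: ue.
Qed.

Lemma cvg_geometric_half (M : R) : (fun n => M / 2 ^+ n) @ \oo --> (0 : R).
Proof.
have := @cvg_geometric R M 2^-1.
rewrite ger0_norm ?invr_ge0// invf_lt1 ?ltr1n// => /(_ isT).
by apply: cvg_trans; apply: near_eq_cvg; near=> n; rewrite /geometric /= exprVn.
Unshelve. all: by end_near. Qed.

Lemma patch_measurable (D : set R) b : measurable D -> measurable_fun setT b ->
  measurable_fun setT (b \_ D).
Proof.
move=> mD mb; apply/(measurable_restrictT b mD).
exact: measurable_funTS.
Qed.

Lemma normr_patch_le (D : set R) b (M : R) : (forall x, `|b x| <= M) ->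
  forall x, `|(b \_ D) x| <= M.
Proof.
move=> bM x; rewrite patchE; case: ifPn => // _.
by rewrite normr0 (le_trans _ (bM x)).
Qed.

Lemma integrable_patch_bounded (D : set R) b (M : R) : measurable D -> (mu D < +oo)%E ->
  measurable_fun setT b -> (forall x, `|b x| <= M) ->
  mu.-integrable setT (EFin \o (b \_ D)).
Proof.
move=> mD Dfin mb bM; rewrite -restrict_EFin; apply/integrable_restrict => //; rewrite setTI.
apply: measurable_bounded_integrable => //; first exact: measurable_funTS.
by exists M; split; [exact: num_real|move=> N MN x _ /=; exact: (le_trans (bM x) (ltW MN))].
Qed.

Lemma convB K a b x :
  mu.-integrable setT (EFin \o (fun y => K (x - y) * a y)) ->
  mu.-integrable setT (EFin \o (fun y => K (x - y) * b y)) ->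
  conv K (fun y => a y - b y) x = conv K a x - conv K b x.
Proof.
by move=> ia ib; rewrite /conv -RintegralB//; apply: eq_Rintegral => y _; rewrite mulrBr.
Qed.

Lemma patchB (D : set R) a b : (fun y => a y - b y) \_ D = (fun y => (a \_ D) y - (b \_ D) y).
Proof. by apply/funext => x; rewrite !patchE; case: ifPn => //; rewrite subr0. Qed.

(* [b] is the limit of the Neumann iteration; subtracting it from [h] keeps the
   iteration among bounded functions although [h] need not be bounded. *)
Lemma exists_neumann_correction (K h : R -> R) (D : set R) (M : R) : measurable D -> (mu D < +oo)%E ->
  mu.-integrable setT (EFin \o K) -> \int[mu]_x `|K x| <= 2^-1 ->
  mu.-integrable setT (EFin \o (h \_ D)) ->
  (forall x, mu.-integrable setT (EFin \o (fun y => K (x - y) * (h \_ D) y))) ->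
  (forall x, `|conv K (h \_ D) x| <= M) ->
  exists b, [/\ measurable_fun setT b, (forall x, `|b x| <= 2 * M) &
    forall x, conv K ((fun y => h y - b y) \_ D) x = b x].
Proof.
move=> mD Dfin iK K2 ih iKh hM.
have M0 : 0 <= M by exact: le_trans (hM 0).
have K0 : 0 <= \int[mu]_x `|K x| by apply: Rintegral_ge0.
pose u0 := conv K (h \_ D).
(* Iterates of [b => conv K ((h - b) \_ D)], a contraction of ratio 1/2 for the sup norm. The ball
   of radius [2 * M] is stable because M + 2M/2 = 2M. *)
pose bs := fix bs n := if n is n.+1 then fun x => u0 x - conv K (bs n \_ D) x else fun=> 0 : R.
have bsS n x : bs n.+1 x = u0 x - conv K (bs n \_ D) x by [].
have iD b : measurable_fun setT b -> (forall x, `|b x| <= 2 * M) ->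
    forall x, mu.-integrable setT (EFin \o (fun y => K (x - y) * (b \_ D) y)).
  move=> mb bM x; apply: (integrable_conv_bounded (M := 2 * M)) => //.
    exact: patch_measurable.
  exact: normr_patch_le.
have cK b (c : R) : measurable_fun setT b -> (forall x, `|b x| <= c) -> 0 <= c ->
    forall x, `|conv K (b \_ D) x| <= c / 2.
  move=> mb bc c0 x.
  apply: le_trans (conv_bounded (M := c) _ _ _ _) _ => //.
  - exact: patch_measurable.
  - exact: normr_patch_le.
  - by rewrite mulrC ler_wpM2l.
have mK b : measurable_fun setT b -> (forall x, `|b x| <= 2 * M) ->
    measurable_fun setT (conv K (b \_ D)).
  move=> mb bM; apply: measurable_conv => //.
  by apply: (integrable_patch_bounded (M := 2 * M)).
have mu0 : measurable_fun setT u0 by exact: measurable_conv.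
have bs_prop n : measurable_fun setT (bs n) /\ forall x, `|bs n x| <= 2 * M.
  elim: n => [|n [mb bM]]; first by split=> [|x]; [exact: measurable_cst|rewrite normr0 mulr_ge0].
  split=> [|x]; first by apply: measurable_funB => //; exact: mK.
  rewrite bsS; apply: (le_trans (ler_normB _ _)).
  rewrite [leRHS](_ : _ = M + 2 * M / 2); last by field.
  apply: lerD; first exact: hM.
  by apply: cK => //; exact: mulr_ge0.
have bs_tail n m : (n <= m)%N -> forall x, `|bs m x - bs n x| <= 2 * M / 2 ^+ n.
  elim: n m => [m _ x|n IH [//|m]]; first by rewrite subr0 expr0 divr1; exact: (bs_prop m).2.
  rewrite ltnS => /IH {}IH x; rewrite !bsS.
  have -> : u0 x - conv K (bs m \_ D) x - (u0 x - conv K (bs n \_ D) x) =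
      - conv K ((fun y => bs m y - bs n y) \_ D) x.
    rewrite patchB convB; first by ring.
      by apply: iD; case: (bs_prop m).
    by apply: iD; case: (bs_prop n).
  rewrite normrN exprSr invfM mulrA; apply: cK => //.
    by apply: measurable_funB; [case: (bs_prop m)|case: (bs_prop n)].
  by rewrite divr_ge0 ?mulr_ge0// exprn_ge0.
pose b x := limn (bs ^~ x).
have bP x := cvg_of_tail_bound (fun n m nm => bs_tail n m nm x) (cvg_geometric_half (2 * M)).
have mb : measurable_fun setT b.
  apply: (measurable_fun_cvg (h := bs)) => //; first by move=> n; case: (bs_prop n).
  by move=> x _; case: (bP x).
have bM x : `|b x| <= 2 * M.
  by have := (bP x).2 0%N; rewrite /= subr0 expr0 divr1.
exists b; split=> // x.
have iKhD : mu.-integrable setT (EFin \o (fun y => K (x - y) * (h \_ D) y)) by [].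
rewrite patchB convB//; last exact: iD.
(* Both sides of the goal are limits of [bs n.+1 x]: the left one by the contraction, the right one
   by the definition of [b]. *)
have cvg1 : (fun n => bs n.+1 x) @ \oo --> u0 x - conv K (b \_ D) x.
  apply/cvgrPdist_le => e e0.
  have /cvgrPdist_le /(_ _ e0) [N _ HN] := cvg_geometric_half (2 * M).
  exists N => // n /= Nn.
  rewrite [X in `|X|](_ : _ = conv K (bs n \_ D) x - conv K (b \_ D) x); last by ring.
  rewrite -convB; last 2 first.
  - by apply: iD; case: (bs_prop n).
  - exact: iD.
  rewrite -patchB.
  apply: (le_trans (cK _ (2 * M / 2 ^+ n) _ _ _ x)).
  - by apply: measurable_funB => //; case: (bs_prop n).
  - by move=> y; rewrite distrC; exact: (bP y).2.
  - by rewrite divr_ge0 ?mulr_ge0// exprn_ge0.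
  apply: le_trans (HN n Nn); rewrite sub0r normrN ger0_norm; last first.
    by rewrite divr_ge0 ?mulr_ge0// exprn_ge0.
  by rewrite ler_pdivrMr// ler_peMr ?ler1n// divr_ge0 ?mulr_ge0// exprn_ge0.
have cvg2 : (fun n => bs n.+1 x) @ \oo --> b x.
  by rewrite (cvg_shiftS (bs ^~ x)); exact: (bP x).1.
exact: cvg_unique cvg1 cvg2.
Qed.

(** The L^1 norm of [g] is at most that of [h] plus half of itself; being finite, it can be
    absorbed. With [h = 0] this gives uniqueness. *)
Lemma integral_equation_bound K h (D : set R) g : measurable D ->
  mu.-integrable setT (EFin \o K) -> \int[mu]_x `|K x| <= 2^-1 ->
  mu.-integrable setT (EFin \o (h \_ D)) -> mu.-integrable setT (EFin \o (g \_ D)) ->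
  {ae mu, forall x, D x -> g x + conv K (g \_ D) x = h x} ->
  \int[mu]_x `|(g \_ D) x| <= 2 * \int[mu]_x `|(h \_ D) x|.
Proof.
move=> mD iK K2 ih ig gh.
have ic := integrable_conv iK ig.
suff : \int[mu]_x `|(g \_ D) x| <= \int[mu]_x (`|(h \_ D) x| + `|conv K (g \_ D) x|).
  rewrite RintegralD//; [|exact: integrable_norm..].
  have := integral_abs_conv iK ig.
  have : 0 <= \int[mu]_x `|(g \_ D) x| by apply: Rintegral_ge0.
  nra.
rewrite -lee_fin !Rintegral_EFin//; last 2 first.
  by apply: (integrableD _ (integrable_norm ih) (integrable_norm ic)).
  exact: (integrable_norm ig).
apply: ae_ge0_le_integral => //.
- apply/measurable_EFinP; apply: measurableT_comp => //; exact: integrable_measurable.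
- apply/measurable_EFinP; apply: measurable_funD.
    by apply: measurableT_comp => //; exact: integrable_measurable.
  by apply: measurableT_comp => //; exact: integrable_measurable.
apply: (ae_imp gh) => {gh} x gh _; rewrite lee_fin !patchE; case: ifPn => [xD|_].
  have -> : g x = h x - conv K (g \_ D) x by rewrite -gh ?addrK//; exact: set_mem.
  exact: ler_normB.
by rewrite normr0 add0r.
Qed.

End integral_equation.

(** * The Fourier transform in L^1 + L^2 *)
Section fourier_transform.
Context {R : realType}.
Notation mu := (@lebesgue_measure R).

(** By Fatou the lower limit of [(v - u n) ^+ 2] has integral 0, hence vanishes almost everywhere;
    where [u n] converges, that lower limit is [(v - U) ^+ 2]. *)
Lemma L2_limit_ae (u : nat -> R -> R) (v U : R -> R) :
  (forall n, measurable_fun setT (u n)) -> measurable_fun setT v ->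
  (fun n => (\int[mu]_x ((v x - u n x) ^+ 2)%:E)%E) @ \oo --> 0%E ->
  {ae mu, forall x, (fun n => u n x) @ \oo --> U x} ->
  {ae mu, forall x, v x = U x}.
Proof.
move=> mu_ mv vu0 uU.
pose phi n x := ((v x - u n x) ^+ 2)%:E.
have mphi n : measurable_fun setT (phi n).
  by apply/measurable_EFinP; apply: measurable_funX; exact: measurable_funB.
have phi0 n x : setT x -> (0 <= phi n x)%E by rewrite lee_fin sqr_ge0.
have := fatou mu measurableT mphi phi0.
rewrite is_cvg_limn_einfE; last by apply/cvg_ex; eexists; exact: vu0.
rewrite (cvg_lim _ vu0)// => int0.
pose L x := limn_einf (phi ^~ x).
have mL : measurable_fun setT L.
  rewrite /L /limn_einf; apply: measurableT_comp => //.
  apply: measurable_fun_limn_esup => n.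
  by apply: measurableT_comp => //.
have L0 x : (0 <= L x)%E.
  rewrite /L limn_einf_lim; apply: lime_ge; first exact: is_cvg_einfs.
  by apply: nearW => n; apply: le_ereal_inf_tmp => _ [m /= nm <-]; exact: phi0.
have : ae_eq mu setT L (cst 0%E).
  apply/ae_eq_integral_abs => //; apply/eqP; rewrite eq_le integral_ge0// andbT.
  by under eq_integral do rewrite gee0_abs//.
move=> aeL; have H := ae_and aeL uU.
apply: (ae_imp H) => x [/(_ I) Lx0 ux].
have phix : (fun n => phi n x) @ \oo --> ((v x - U x) ^+ 2)%:E.
  apply: cvg_EFin; first by apply: nearW.
  rewrite /comp /=.
  apply: (@cvg_comp _ _ _ (fun n => v x - u n x) (fun z : R => z ^+ 2) _ (nbhs (v x - U x))).
    by apply: cvgB => //; exact: cvg_cst.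
  exact: exprn_continuous.
move: Lx0; rewrite /L is_cvg_limn_einfE; last by apply/cvg_ex; eexists; exact: phix.
rewrite (cvg_lim _ phix)//= => -[/eqP]; rewrite sqrf_eq0 subr_eq0 => /eqP.
by [].
Qed.

Lemma Rdominated_cvg (D : set R) (f_ : nat -> R -> R) (f : R -> R) (g : R -> \bar R) :
  measurable D -> (forall n, measurable_fun D (f_ n)) -> measurable_fun D f ->
  {ae mu, forall x, D x -> (fun n => f_ n x) @ \oo --> f x} ->
  mu.-integrable D g -> (forall x n, D x -> (`|f_ n x|%:E <= g x)%E) ->
  (fun n => \int[mu]_(x in D) f_ n x) @ \oo --> \int[mu]_(x in D) f x.
Proof.
move=> mD mf_ mf f_f ig f_g.
have [||||fi _ dc] := @dominated_convergence _ _ _ mu D mD (fun n x => (f_ n x)%:E)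
  (fun x => (f x)%:E) g _ _ _ ig _.
- by move=> n; apply/measurable_EFinP; exact: mf_.
- exact/measurable_EFinP.
- by apply: (ae_imp f_f) => x fx Dx; apply: cvg_EFin; [exact: nearW|exact: fx].
- by apply: aeW => x n Dx; exact: f_g.
by apply: fine_cvg; rewrite fineK//; exact: integrable_fin_num.
Qed.

Lemma fourierL1E (f : R -> R) (x : R) : fourierL1 f x =
  Complex ((2 * pi)^-1 * \int[mu]_l (f l * cos (l * x)))
          ((2 * pi)^-1 * \int[mu]_l (f l * sin (l * x))).
Proof.
rewrite /fourierL1 /cintegral /expi.
rewrite (_ : (fun l => complex.Re _) = fun l => f l * cos (l * x)); last first.
  by apply/funext => l /=; rewrite mul0r subr0.
rewrite (_ : (fun l => complex.Im _) = fun l => f l * sin (l * x)); last first.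
  by apply/funext => l /=; rewrite mul0r addr0.
by apply/eqP; rewrite eq_complex /= !mul0r subr0 addr0 !eqxx.
Qed.

Section trigonometric_integrals.
Variable t : R -> R.
Hypothesis t1 : forall x, `|t x| <= 1.
Hypothesis ct : continuous t.

Lemma measurable_trig (x : R) : measurable_fun setT (fun l : R => t (l * x)).
Proof.
apply: (measurableT_comp (continuous_measurable_fun ct)).
exact: mulrr_measurable.
Qed.

Lemma integrable_trig (f : R -> R) (x : R) : mu.-integrable setT (EFin \o f) ->
  mu.-integrable setT (EFin \o (fun l => f l * t (l * x))).
Proof.
by move=> fi; apply: (integrable_mul_bounded (M := 1)) => //; exact: measurable_trig.
Qed.

Lemma measurable_trig_transform (f : R -> R) : mu.-integrable setT (EFin \o f) ->
  measurable_fun setT (fun x : R => \int[mu]_l (f l * t (l * x))).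
Proof.
move=> fi; apply: continuous_measurable_fun => x.
apply: (@continuity_under_integral _ _ _ mu (fun x l => f l * t (l * x)) setT measurableT
  (x - 1) (x + 1) _ _ (fun l => `|f l|)).
- by move=> y _; exact: integrable_trig.
- apply: aeW => l _ y _.
  apply: cvgM; first exact: cvg_cst.
  apply: (@continuous_comp _ _ _ (fun x => l * x) t y); last exact: ct.
  exact: mulrl_continuous.
- exact: integrable_norm.
- move=> y _; apply: aeW => l _.
  by rewrite normrM ler_piMr.
- by rewrite inE/= in_itv/=; apply/andP; split; lra.
Qed.

Lemma cvg_trig_truncation (f : R -> R) (x : R) : mu.-integrable setT (EFin \o f) ->
  (fun n : nat => \int[mu]_l ((f \* \1_(`[- n%:R, n%:R])) l * t (l * x))) @ \oo -->
  \int[mu]_l (f l * t (l * x)).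
Proof.
move=> fi.
have mf := integrable_measurable fi.
apply: (@Rdominated_cvg _ _ _ (fun l => `|f l|%:E)) => //.
- move=> n; apply: measurable_funM; last exact: measurable_trig.
  by apply: measurable_funM => //; exact: measurable_indic.
- by apply: measurable_funM => //; exact: measurable_trig.
- apply: aeW => l _; apply: cvg_near_cst; near=> n.
  rewrite /= indicE mem_set ?mulr1//= in_itv/= -ler_norml.
  by near: n; exact: nbhs_infty_ger.
- exact: integrable_norm.
- move=> l n _; rewrite lee_fin normrM normrM indicE.
  rewrite -[leRHS]mulr1 -mulrA ler_wpM2l//.
  by rewrite mulr_ile1// normr_nat; case: (_ \in _).
Unshelve. all: by end_near. Qed.

End trigonometric_integrals.

Lemma integrable_truncation (f : R -> R) (n : nat) : f \in Lfun mu 2%:E ->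
  mu.-integrable setT (EFin \o (f \* \1_(`[- n%:R, n%:R]))).
Proof.
move=> f2; have f22 := Lfun2_integrable_sqr f2.
have mf : measurable_fun setT f by move: f2; rewrite inE => /andP[/[!inE]].
have i1 : mu.-integrable setT (EFin \o (\1_(`[- n%:R : R, n%:R]) : R -> R)).
  exact: integrable_indic_itv.
apply: (le_integrable _ _ _ (integrableD _ f22 i1)) => //.
  by apply/measurable_EFinP; apply: measurable_funM => //; exact: measurable_indic.
move=> x _ /=; rewrite lee_fin [leRHS]ger0_norm; last by rewrite addr_ge0 ?sqr_ge0.
rewrite indicE normrM normr_nat; case: (_ \in _) => /=; last by rewrite mulr0 addr0 sqr_ge0.
rewrite mulr1.
rewrite -real_normK ?num_real//; have : 0 <= `|f x| by []; nra.
Qed.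

Lemma cabs_sqr (z : R[i]) : cabs z ^+ 2 = complex.Re z ^+ 2 + complex.Im z ^+ 2.
Proof. by case: z => a b; rewrite /cabs /= sqr_sqrtr// addr_ge0// sqr_ge0. Qed.

Lemma cabs_sqrB (z w : R[i]) : cabs (z - w) ^+ 2 =
  (complex.Re z - complex.Re w) ^+ 2 + (complex.Im z - complex.Im w) ^+ 2.
Proof. by rewrite cabs_sqr; case: z w => [a b] [c d]. Qed.

(** The splitting [f = f1 \+ f2] behind [F] is arbitrary. The truncated transforms of [f1] converge
    everywhere, so those of [f2] converge almost everywhere to [G] minus the transform of [f1].
    [L2_limit_ae] identifies this limit with [F2], and the sum is [G] whatever the splitting. *)
Lemma fourier_ae (f G : R -> R) (F : R -> R[i]) : is_fourier f F ->
  {ae mu, forall x, (fun n : nat => complex.Re (fourierL1 (f \* \1_(`[- n%:R, n%:R])) x)) @ \oo --> G x} ->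
  (forall n : nat, forall x, complex.Im (fourierL1 (f \* \1_(`[- n%:R, n%:R])) x) = 0) ->
  {ae mu, forall x, F x = Complex (G x) 0}.
Proof.
move=> [f1 [f2 [F2 [hf1 hf2 fE [[mReF2 mImF2] L2] FE]]]] Gc Im0.
have i1 : mu.-integrable setT (EFin \o f1) by apply/Lfun1_integrable.
have i2n n := integrable_truncation n hf2.
have i1n (n : nat) : mu.-integrable setT (EFin \o (f1 \* \1_(`[- n%:R, n%:R]))).
  apply: (integrable_mul_bounded (M := 1)) => //.
  by move=> x; rewrite indicE normr_nat; case: (_ \in _).
have fsplit (t : R -> R) : (forall x, `|t x| <= 1) -> continuous t -> forall (n : nat) x,
    \int[mu]_l ((f2 \* \1_(`[- n%:R, n%:R])) l * t (l * x)) =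
    \int[mu]_l ((f \* \1_(`[- n%:R, n%:R])) l * t (l * x)) -
    \int[mu]_l ((f1 \* \1_(`[- n%:R, n%:R])) l * t (l * x)).
  move=> t1 ct n x; apply/esym/eqP; rewrite subr_eq; apply/eqP.
  rewrite -RintegralD//; [|exact: integrable_trig..].
  by apply: eq_Rintegral => l _; rewrite fE /=; ring.
pose a n x := fourierL1 (f2 \* \1_(`[- n%:R, n%:R])) x.
have ccos := @continuous_cos R; have csin := @continuous_sin R.
have bcos (x : R) : `|cos x| <= 1 by rewrite ler_norml cos_geN1 cos_le1.
have bsin (x : R) : `|sin x| <= 1 by rewrite ler_norml sin_geN1 sin_le1.
have mRe n : measurable_fun setT (fun x => complex.Re (a n x)).
  under eq_fun do rewrite /a fourierL1E /=.
  by apply: measurable_funM => //; exact: (measurable_trig_transform bcos ccos (i2n n)).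
have mIm n : measurable_fun setT (fun x => complex.Im (a n x)).
  under eq_fun do rewrite /a fourierL1E /=.
  by apply: measurable_funM => //; exact: (measurable_trig_transform bsin csin (i2n n)).
have L2part (v : R -> R) (u : nat -> R -> R) :
    (forall n, measurable_fun setT (u n)) -> measurable_fun setT v ->
    (forall n x, (v x - u n x) ^+ 2 <= cabs (F2 x - a n x) ^+ 2) ->
    (fun n => (\int[mu]_x ((v x - u n x) ^+ 2)%:E)%E) @ \oo --> 0%E.
  move=> mu_ mv vu.
  apply: (@squeeze_cvge _ _ _ _ (fun=> 0%E) _ _ _ _ _ L2); last exact: cvg_cst.
  apply: nearW => n; apply/andP; split; first by apply: integral_ge0 => x _; rewrite lee_fin sqr_ge0.
  apply: ge0_le_integral => //.
  - by move=> x _; rewrite lee_fin sqr_ge0.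
  - apply/measurable_EFinP; apply: measurable_funX; apply: measurable_funB => //; exact: mu_.
  - apply/measurable_EFinP; under eq_fun do rewrite cabs_sqrB.
    by apply: measurable_funD; apply: measurable_funX; apply: measurable_funB => //; [exact: mRe|exact: mIm].
  - by move=> x _; rewrite lee_fin; exact: vu.
have aRe : {ae mu, forall x, complex.Re (F2 x) = G x - complex.Re (fourierL1 f1 x)}.
  apply: (L2_limit_ae mRe mReF2).
    by apply: L2part => // n x; rewrite cabs_sqrB lerDl sqr_ge0.
  apply: (ae_imp Gc) => x Gx.
  rewrite (_ : (fun n => complex.Re (a n x)) = fun n =>
      complex.Re (fourierL1 (f \* \1_(`[- n%:R, n%:R])) x) -
      (2 * pi)^-1 * \int[mu]_l ((f1 \* \1_(`[- n%:R, n%:R])) l * cos (l * x))); last first.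
    by apply/funext => n; rewrite /a !fourierL1E /= fsplit// mulrBr.
  apply: cvgB => //; rewrite fourierL1E /=; apply: cvgM; first exact: cvg_cst.
  exact: cvg_trig_truncation.
have aIm : {ae mu, forall x, complex.Im (F2 x) = 0 - complex.Im (fourierL1 f1 x)}.
  apply: (L2_limit_ae mIm mImF2).
    by apply: L2part => // n x; rewrite cabs_sqrB lerDr sqr_ge0.
  apply: aeW => x.
  rewrite (_ : (fun n => complex.Im (a n x)) = fun n => 0 -
      (2 * pi)^-1 * \int[mu]_l ((f1 \* \1_(`[- n%:R, n%:R])) l * sin (l * x))); last first.
    apply/funext => n; rewrite /a !fourierL1E /= fsplit// mulrBr; congr (_ - _).
    by have := Im0 n x; rewrite fourierL1E.
  apply: cvgB; first exact: cvg_cst.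
  rewrite fourierL1E /=; apply: cvgM; first exact: cvg_cst.
  exact: cvg_trig_truncation.
apply: (ae_imp (ae_and aRe aIm)) => x [h1 h2].
rewrite FE; move: (fourierL1 f1 x) (F2 x) h1 h2 => [p q] [p' q'] /= -> ->.
by apply/eqP; rewrite eq_complex /=; apply/andP; split; apply/eqP; ring.
Qed.

End fourier_transform.

(** * Cosine transforms of blocks *)
Section trigonometric_blocks.
Context {R : realType}.
Notation mu := (@lebesgue_measure R).

Lemma continuous_cos_affine (al be : R) : continuous (fun x : R => cos (al * x + be)).
Proof.
move=> x; apply: continuous_comp; last exact: continuous_cos.
by apply: cvgD; [exact: mulrl_continuous|exact: cvg_cst].
Qed.

Lemma integral_cos_affine (a b al be : R) : a <= b -> al != 0 ->
  \int[mu]_(x in `[a, b]) cos (al * x + be) = (sin (al * b + be) - sin (al * a + be)) / al.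
Proof.
rewrite le_eqVlt => /predU1P[->|ab] al0; first by rewrite set_itv1 Rintegral_set1 subrr mul0r.
have dF (x : R) : is_derive x 1 (fun x : R => sin (al * x + be) / al) (cos (al * x + be)).
  apply: is_derive_eq; rewrite /GRing.scale /=; field.
  exact: al0.
have cF : continuous (fun x : R => sin (al * x + be) / al).
  by move=> x; apply: differentiable_continuous; apply/derivable1_diffP; exact: (ex_derive).
rewrite /Rintegral (@continuous_FTC2 _ _ (fun x : R => sin (al * x + be) / al))//.
- by rewrite /= mulrBl.
- by apply: continuous_subspaceT; exact: continuous_cos_affine.
- split.
  + by move=> x _; exact: ex_derive.
  + by apply: cvg_at_right_filter; exact: cF.
  + by apply: cvg_at_left_filter; exact: cF.
- by move=> x _; rewrite derive1E; exact: derive_val.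
Qed.

Lemma lebesgue_measure_itvcc_lty (a b : R) : (mu `[a, b] < +oo)%E.
Proof. by rewrite lebesgue_measure_itv/=; case: ifPn => // _; rewrite -EFinB ltry. Qed.

Lemma integrable_bounded_itv (a b M : R) (f : R -> R) : measurable_fun setT f ->
  (forall x, `|f x| <= M) -> mu.-integrable `[a, b] (EFin \o f).
Proof.
move=> mf fM; apply: measurable_bounded_integrable => //.
- exact: lebesgue_measure_itvcc_lty.
- exact: measurable_funTS.
exists M; split; [exact: num_real|move=> N MN x _ /=].
by rewrite (le_trans _ (ltW MN)).
Qed.

Lemma integrable_cos_affine (a b al be : R) :
  mu.-integrable `[a, b] (EFin \o (fun x => cos (al * x + be))).
Proof.
apply: (@integrable_bounded_itv _ _ 1).
  by apply: continuous_measurable_fun; exact: continuous_cos_affine.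
by move=> x; rewrite ler_norml cos_geN1 cos_le1.
Qed.

Lemma Rintegral_cst_itv (a b c : R) : a <= b -> \int[mu]_(x in `[a, b]) c = c * (b - a).
Proof.
move=> ab; rewrite /Rintegral integral_cst//= lebesgue_measure_itv/= lte_fin.
case: ifPn => [_|]; first by rewrite -EFinB.
by rewrite -leNgt => ba; rewrite (le_anti (introT andP (conj ab ba))) subrr mulr0 mule0.
Qed.

Lemma normr_integral_cos_affine_le (a b al be : R) : a <= b ->
  `|\int[mu]_(x in `[a, b]) cos (al * x + be)| <= b - a.
Proof.
move=> ab; apply: (le_trans (le_normr_Rintegral _ (integrable_cos_affine _ _ _ _))) => //.
apply: (@le_trans _ _ (\int[mu]_(x in `[a, b]) 1)).
  apply: le_Rintegral => //.
  - by apply: integrable_norm; exact: integrable_cos_affine.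
  - by apply: (@integrable_bounded_itv _ _ 1) => // x; rewrite normr1.
  - by move=> x _; rewrite ler_norml cos_geN1 cos_le1.
by rewrite Rintegral_cst_itv// mul1r.
Qed.

Lemma normr_integral_cos_affine_le2 (a b al be : R) : a <= b -> al != 0 ->
  `|\int[mu]_(x in `[a, b]) cos (al * x + be)| <= 2 / `|al|.
Proof.
move=> ab al0; rewrite integral_cos_affine// normrM normfV ler_pM2r ?invr_gt0 ?normr_gt0//.
apply: (le_trans (ler_normB _ _)).
have sin1 (x : R) : `|sin x| <= 1 by rewrite ler_norml sin_geN1 sin_le1.
have := sin1 (al * b + be); have := sin1 (al * a + be); lra.
Qed.

(** Cauchy-Schwarz with weights 2^-(k+1), of total less than 1. The induction peels off the first
    term with (a + S)^2 <= 2a^2 + 2S^2. *)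
Lemma sqr_sum_le (u : nat -> R) (n : nat) :
  (\sum_(k < n) u k) ^+ 2 <= \sum_(k < n) 2 ^+ k.+1 * u k ^+ 2.
Proof.
elim: n u => [u|n IH u]; first by rewrite !big_ord0 expr0n.
rewrite !big_ord_recl.
have := IH (fun k => u k.+1).
rewrite -(@ler_pM2l _ 2)// mulr_sumr => H.
under [X in _ <= _ + X]eq_bigr => i _ do rewrite exprS -mulrA.
set S := \sum_(i < n) u _; set T := \sum_(i < n) 2 * _.
have {}H : 2 * S ^+ 2 <= T by [].
have : 0 <= (u 0%N - S) ^+ 2 by exact: sqr_ge0.
rewrite /= expr1; nra.
Qed.

(** Up to a constant, the integrand is the envelope of the squared transform of a block of width
    [n]. An integral of order [n] is the size that Plancherel predicts. *)
Lemma integral_cauchy_density (n : R) : 0 < n ->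
  (\int[mu]_x (n ^+ 2 / (1 + n ^+ 2 * x ^+ 2))%:E = (n * pi)%:E)%E.
Proof.
move=> n0.
have den (x : R) : 0 < 1 + n ^+ 2 * x ^+ 2.
  by rewrite ltr_wpDr// mulr_ge0// sqr_ge0.
have cf : continuous (fun x : R => n ^+ 2 / (1 + n ^+ 2 * x ^+ 2)).
  move=> x; apply: cvgM; first exact: cvg_cst.
  apply: cvgV; first by rewrite gt_eqF.
  apply: cvgD; first exact: cvg_cst.
  by apply: cvgM; [exact: cvg_cst|exact: exprn_continuous].
rewrite ge0_symfun_integralT//; last 2 first.
- by move=> x; rewrite divr_ge0 ?sqr_ge0// ltW.
- by move=> x /=; rewrite sqrrN.
have dF (x : R) : is_derive x 1 (fun x : R => n * atan (n * x)) (n ^+ 2 / (1 + n ^+ 2 * x ^+ 2)).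
  apply: is_derive_eq; rewrite /GRing.scale /=; field.
  by rewrite exprMn gt_eqF.
have cF : continuous (fun x : R => n * atan (n * x)).
  by move=> x; apply: differentiable_continuous; apply/derivable1_diffP; exact: (ex_derive).
rewrite -set_itvcy (@ge0_continuous_FTC2y _ _ (fun x : R => n * atan (n * x)) 0 (n * (pi / 2)))//.
- rewrite mulr0 atan0 mulr0 sube0 -EFinM; congr (_%:E); field.
- by [].
- by move=> x _; rewrite divr_ge0 ?sqr_ge0// ltW.
- by apply: continuous_subspaceT.
- apply: cvgM; first exact: cvg_cst.
  apply: (@cvg_comp _ _ _ (fun x : R => n * x) (@atan R) _ _ _ _ (@cvgy_atan R)).
  apply/cvgryPge => A; exists (A / n); split; first exact: num_real.
  by move=> x /ltW /=; rewrite ler_pdivrMr// mulrC.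
- apply: cvg_at_right_filter.
  exact: cF.
- by move=> x _; rewrite derive1E; exact: derive_val.
Qed.

End trigonometric_blocks.

(** * Symmetric blocks, Fubini on rectangles, and the overlap of two cosines *)

Section blocks.
Context {R : realType}.
Notation mu := (@lebesgue_measure R).

Lemma sum_half_le (n : nat) : \sum_(k < n) (2 ^+ k)^-1 <= 2 :> R.
Proof.
suff -> : \sum_(k < n) (2 ^+ k)^-1 = 2 - 2 / 2 ^+ n :> R.
  by rewrite gerBl divr_ge0// exprn_ge0.
elim: n => [|n IH]; first by rewrite big_ord0 expr0 divr1 subrr.
rewrite big_ord_recr /= IH exprS; field.
by rewrite expf_neq0.
Qed.

Lemma nneseries_half_le (a : nat -> \bar R) (A : R) :
  (forall k, 0 <= a k)%E -> (forall k, a k <= (A / 2 ^+ k)%:E)%E ->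
  (\sum_(k <oo) a k <= (2 * A)%:E)%E.
Proof.
move=> a0 aA; apply: lime_le; first by apply: is_cvg_nneseries.
apply: nearW => n.
have A0 : 0 <= A.
  by have := le_trans (a0 0%N) (aA 0%N); rewrite expr0 divr1 lee_fin.
apply: (@le_trans _ _ (\sum_(0 <= k < n) (A / 2 ^+ k)%:E)%E); first exact: lee_sum.
rewrite big_mkord sumEFin lee_fin -mulr_sumr mulrC ler_wpM2r//.
exact: sum_half_le.
Qed.

Lemma measurable_nneseries (h : nat -> R -> \bar R) : (forall k x, 0 <= h k x)%E ->
  (forall k, measurable_fun setT (h k)) ->
  measurable_fun setT (fun x => \sum_(k <oo) h k x)%E.
Proof.
move=> h0 mh; apply: (emeasurable_fun_cvg (fun n x => \sum_(0 <= k < n) h k x)%E).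
  by move=> n; exact: emeasurable_sum.
by move=> x _; apply: is_cvg_nneseries => k _ _; exact: h0.
Qed.

Lemma nneseries_term_le (a : nat -> \bar R) (k : nat) : (forall k, 0 <= a k)%E ->
  (a k <= \sum_(i <oo) a i)%E.
Proof.
move=> a0; apply: le_trans (nneseries_lim_ge k.+1 _) => //.
by rewrite big_nat_recr//= leeDr// sume_ge0.
Qed.

Lemma Rintegral_sum (D : set R) (n : nat) (h : nat -> R -> R) : measurable D ->
  (forall k, mu.-integrable D (EFin \o h k)) ->
  mu.-integrable D (EFin \o (fun x => \sum_(k < n) h k x)) /\
  \int[mu]_(x in D) (\sum_(k < n) h k x) = \sum_(k < n) \int[mu]_(x in D) h k x.
Proof.
move=> mD hi; elim: n => [|n [IH1 IH2]].
  split; last first.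
    by under eq_Rintegral do rewrite big_ord0; rewrite /Rintegral integral0 big_ord0.
  by under [X in _ \o X]eq_fun do rewrite big_ord0; exact: integrable0.
split; first by under [X in _ \o X]eq_fun do rewrite big_ord_recr /=; exact: (integrableD _ IH1 (hi n)).
under eq_Rintegral do rewrite big_ord_recr /=.
by rewrite RintegralD// IH2 big_ord_recr.
Qed.

Lemma integrable_indic_mul (a b : R) (t : R -> R) : measurable_fun setT t ->
  (forall x, `|t x| <= 1) ->
  mu.-integrable setT (EFin \o (fun l => \1_(`[a, b]) l * t l)).
Proof.
move=> mt t1; apply: (integrable_mul_bounded (M := 1)) => //.
exact: integrable_indic_itv.
Qed.

(** With [0 < a], the block and its mirror image are disjoint. *)
Lemma indic_normr (a b l : R) : 0 < a ->
  \1_(`[a, b]) `|l| = \1_(`[a, b]) l + \1_(`[a, b]) (0 - l) :> R.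
Proof.
move=> a0; rewrite !indicE sub0r.
have [l0|l0] := leP 0 l.
  rewrite (_ : (- l \in `[a, b]%classic) = false) ?addr0 ?ger0_norm//.
  by apply/memNset; rewrite /= in_itv/= => /andP[]; lra.
rewrite [in RHS](_ : (l \in `[a, b]%classic) = false) ?add0r ?ltr0_norm//.
by apply/memNset; rewrite /= in_itv/= => /andP[]; lra.
Qed.

Lemma integrable_indic_normr_mul (a b : R) (t : R -> R) : 0 < a -> measurable_fun setT t ->
  (forall x, `|t x| <= 1) ->
  mu.-integrable setT (EFin \o (fun l => \1_(`[a, b]) `|l| * t l)).
Proof.
move=> a0 mt t1; apply: (integrable_mul_bounded (M := 1)) => //.
have i1 : mu.-integrable setT (EFin \o (\1_(`[a, b]) : R -> R)) by exact: integrable_indic_itv.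
apply: eq_integrable (integrableD _ i1 (integrable_reflect 0 i1)) => // l _.
by rewrite /= indic_normr.
Qed.

Lemma integral_indic_normr (a b : R) (t : R -> R) : 0 < a -> measurable_fun setT t ->
  (forall x, `|t x| <= 1) ->
  \int[mu]_l (\1_(`[a, b]) `|l| * t l) = \int[mu]_(l in `[a, b]) (t l + t (- l)).
Proof.
move=> a0 mt t1.
have i1 := @integrable_indic_mul a b _ mt t1.
have mt' : measurable_fun setT (fun l : R => t (0 - l)).
  by apply: (measurableT_comp mt); exact: measurable_subl.
have i2 := @integrable_indic_mul a b _ mt' (fun x => t1 (0 - x)).
transitivity (\int[mu]_l (\1_(`[a, b]) l * t l + \1_(`[a, b]) (0 - l) * t l)).
  by apply: eq_Rintegral => l _; rewrite indic_normr// mulrDl.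
have E l : \1_(`[a, b]) (0 - l) * t l = (fun l => \1_(`[a, b]) l * t (0 - l)) (0 - l).
  by rewrite /= subKr.
have i3 : mu.-integrable setT (EFin \o (fun l => \1_(`[a, b]) (0 - l) * t l)).
  by apply: eq_integrable (integrable_reflect 0 i2) => // l _; rewrite /= subKr.
rewrite [LHS]RintegralD//.
under [X in _ + X]eq_Rintegral do rewrite E.
rewrite (@Rintegral_reflect _ 0 (fun l => \1_(`[a, b]) l * t (0 - l))); last exact: integrable_measurable i2.
rewrite -RintegralD// [RHS]Rintegral_mkcond; apply: eq_Rintegral => l _.
rewrite patchE !indicE sub0r; case: (l \in _) => /=; first by rewrite !mul1r.
by rewrite !mul0r addr0.
Qed.

Lemma integral_indic_normr_measure (a b : R) : 0 < a -> a <= b ->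
  (\int[mu]_l (\1_(`[a, b]) `|l| : R)%:E = (2 * (b - a))%:E)%E.
Proof.
move=> a0 ab.
have mI : measurable_fun setT (fun l : R => (\1_(`[a, b]) l : R)%:E).
  by apply/measurable_EFinP; exact: measurable_indic.
under eq_integral do rewrite indic_normr// EFinD.
rewrite ge0_integralD//; last first.
  by apply: (measurableT_comp mI); exact: measurable_subl.
rewrite (@integral_reflect _ 0 (fun l => (\1_(`[a, b]) l : R)%:E))//.
rewrite integral_indic//= setIT lebesgue_measure_itv/= lte_fin.
case: ifPn => [_|]; first by rewrite -EFinB -EFinD; congr (_%:E); ring.
by rewrite -leNgt => ba; rewrite (le_anti (introT andP (conj ab ba))) subrr mulr0 adde0.
Qed.

(** The inner real integrals agree with the extended ones only where the latter are finite, that is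
    almost everywhere; hence an [ae_eq_integral] on each side of Fubini. *)
Lemma Rfubini (F : R * R -> R) : (mu \x mu)%E.-integrable setT (EFin \o F) ->
  \int[mu]_x \int[mu]_y F (x, y) = \int[mu]_y \int[mu]_x F (x, y).
Proof.
move=> iF; have fin1 := ae_integrable1 iF; have fin2 := ae_integrable2 iF.
rewrite {1 3}/Rintegral; congr fine.
transitivity (\int[mu]_x \int[mu]_y (F (x, y))%:E)%E.
  apply: ae_eq_integral => //.
  - apply/measurable_EFinP; apply: (measurableT_comp (fine_measurable measurableT)).
    exact: measurable_fubini_F iF.
  - exact: measurable_fubini_F iF.
  - by apply: (ae_imp fin1) => x fx _; rewrite fineK//; exact: integrable_fin_num.
transitivity (\int[mu]_y \int[mu]_x (F (x, y))%:E)%E; first exact: Fubini iF.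
apply: ae_eq_integral => //.
- exact: measurable_fubini_G iF.
- apply/measurable_EFinP; apply: (measurableT_comp (fine_measurable measurableT)).
  exact: measurable_fubini_G iF.
- by apply: (ae_imp fin2) => x fx _; rewrite fineK//; exact: integrable_fin_num.
Qed.

Lemma Rfubini_itv (k : R * R -> R) (M a b c e : R) :
  measurable_fun setT k -> (forall z, `|k z| <= M) ->
  \int[mu]_(x in `[a, b]) \int[mu]_(l in `[c, e]) k (x, l) =
  \int[mu]_(l in `[c, e]) \int[mu]_(x in `[a, b]) k (x, l).
Proof.
move=> mk kM.
pose P : set (R * R) := `[a, b] `*` `[c, e].
have mP : measurable P by exact: measurableX.
have iP : (mu \x mu)%E.-integrable setT (EFin \o (k \_ P)).
  rewrite -restrict_EFin; apply/integrable_restrict => //; rewrite setTI.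
  apply: measurable_bounded_integrable => //.
  - apply: (@le_lt_trans _ _ (mu `[a, b] * mu `[c, e])%E).
      by rewrite -(@product_measure1E _ _ _ _ R mu mu).
    apply: lte_mul_pinfty => //; last exact: lebesgue_measure_itvcc_lty.
    by rewrite ge0_fin_numE//; exact: lebesgue_measure_itvcc_lty.
  - exact: measurable_funTS.
  - by exists M; split; [exact: num_real|move=> M' MM' z _ /=; rewrite (le_trans (kM z))// ltW].
have := Rfubini iP.
rewrite [in X in X = _ -> _](_ : (fun x => _) = (fun x => \int[mu]_(l in `[c, e]) k (x, l)) \_ `[a, b]); last first.
  apply/funext => x; rewrite patchE; case: ifPn => xab; last first.
    rewrite (_ : (fun y => _) = fun=> 0) ?/Rintegral ?integral0//.
    apply/funext => l; rewrite patchE memNset// => -[/= h _]; by rewrite mem_set in xab.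
  rewrite [RHS]Rintegral_mkcond; apply: eq_Rintegral => l _; rewrite !patchE.
  congr (if _ then _ else _).
  by rewrite /P in_setX /= xab.
rewrite -Rintegral_mkcond => ->.
rewrite [in LHS](_ : (fun y => _) = (fun l => \int[mu]_(x in `[a, b]) k (x, l)) \_ `[c, e]); last first.
  apply/funext => l; rewrite patchE; case: ifPn => lce; last first.
    rewrite (_ : (fun y => _) = fun=> 0) ?/Rintegral ?integral0//.
    apply/funext => x; rewrite patchE memNset// => -[/= _ h]; by rewrite mem_set in lce.
  rewrite [RHS]Rintegral_mkcond; apply: eq_Rintegral => x _; rewrite !patchE.
  congr (if _ then _ else _).
  by rewrite /P in_setX /= lce andbT.
by rewrite -Rintegral_mkcond.
Qed.

(** The response at frequency [lam] on [[0, r]] to a single frequency [l] of the kernel translated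
    by [y]. *)
Definition cos_overlap (r lam y l : R) : R :=
  \int[mu]_(x in `[0, r]) (cos (l * (x - y)) * cos (lam * x)).

Lemma cos_overlapE r lam y l : cos_overlap r lam y l =
  2^-1 * (\int[mu]_(x in `[0, r]) cos ((lam - l) * x + l * y) +
          \int[mu]_(x in `[0, r]) cos ((lam + l) * x + - (l * y))).
Proof.
rewrite -RintegralD//; [|exact: integrable_cos_affine..].
rewrite -RintegralZl//; last first.
  by apply: (integrableD _ (integrable_cos_affine _ _ _ _) (integrable_cos_affine _ _ _ _)).
apply: eq_Rintegral => x _.
rewrite (_ : (lam - l) * x + l * y = lam * x - l * (x - y)); last by ring.
rewrite (_ : (lam + l) * x + - (l * y) = lam * x + l * (x - y)); last by ring.
by rewrite cosB cosD; field.
Qed.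

Lemma cos_overlap_le r lam y l : 0 <= r -> `|cos_overlap r lam y l| <= r.
Proof.
move=> r0; rewrite cos_overlapE normrM ger0_norm ?invr_ge0//.
have h1 := normr_integral_cos_affine_le (lam - l) (l * y) r0.
have h2 := normr_integral_cos_affine_le (lam + l) (- (l * y)) r0.
have := ler_normD (\int[mu]_(x in `[0, r]) cos ((lam - l) * x + l * y))
  (\int[mu]_(x in `[0, r]) cos ((lam + l) * x + - (l * y))).
lra.
Qed.

(** Both frequencies of the product formula are at least [G] in modulus, since [lam + l] exceeds
    [|lam - l|]; each oscillating integral is then at most 2/G, uniformly in [r]. *)
Lemma cos_overlap_le2 r lam y l (G : R) : 0 <= r -> 0 < lam -> 0 < l -> 0 < G -> G <= `|lam - l| ->
  `|cos_overlap r lam y l| <= 2 / G.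
Proof.
move=> r0 lam0 l0 G0 Gl; rewrite cos_overlapE normrM ger0_norm ?invr_ge0//.
have a0 : 0 < `|lam - l| by exact: lt_le_trans Gl.
have b0 : 0 < lam + l by exact: addr_gt0.
have a_neq0 : lam - l != 0 by rewrite -normr_gt0.
have b_neq0 : lam + l != 0 by rewrite gt_eqF.
have h1 := normr_integral_cos_affine_le2 (l * y) r0 a_neq0.
have h2 := normr_integral_cos_affine_le2 (- (l * y)) r0 b_neq0.
have e1 : 2 / `|lam - l| <= 2 / G by rewrite ler_pM2l// lef_pV2.
have e2 : 2 / `|lam + l| <= 2 / G.
  rewrite ler_pM2l// lef_pV2// ?posrE ?normr_gt0 ?gt_eqF//.
  apply: (le_trans Gl); rewrite (gtr0_norm b0) ler_norml; apply/andP; split; lra.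
have := ler_normD (\int[mu]_(x in `[0, r]) cos ((lam - l) * x + l * y))
  (\int[mu]_(x in `[0, r]) cos ((lam + l) * x + - (l * y))).
lra.
Qed.

Lemma cos_ge_half (u : R) : `|u| <= 1 -> 2^-1 <= cos u.
Proof.
(* [sin b] is the integral of [cos] over [[0, b]]. The claim follows from cos u = 1 - 2 sin(u/2)^2,
   which is at least 1 - u^2/2. *)
have sin_le (b : R) : 0 <= b -> `|sin b| <= b.
  move=> b0; have := normr_integral_cos_affine_le 1 0 b0.
  by rewrite integral_cos_affine ?oner_eq0// !mul1r !addr0 sin0 divr1 !subr0.
rewrite -cos_norm; have : 0 <= `|u| by []; move: (`|u| : R) => v v0' v1.
have v0 : 0 <= v / 2 by rewrite divr_ge0.
rewrite (_ : v = (v / 2) *+ 2); last by rewrite -mulr_natr; field.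
rewrite cos_mulr2n cos2sin2.
have := sin_le _ v0; rewrite ler_norml => /andP[h1 h2].
have : sin (v / 2) ^+ 2 <= (v / 2) ^+ 2 by nra.
have : (v / 2) ^+ 2 <= 4^-1 by nra.
lra.
Qed.

(** The difference frequency turns by at most one radian and contributes at least r/2. The sum
    frequency contributes at most 2/(lam + l) <= r/8, which is where the 16 comes from. Half of r/2
    - r/8 exceeds r/8. *)
Lemma cos_overlap0_ge r lam l : 0 < r -> 0 < lam -> 0 < l -> `|lam - l| * r <= 1 ->
  16 <= (lam + l) * r -> r / 8 <= cos_overlap r lam 0 l.
Proof.
move=> r0 lam0 l0 h1 h2; rewrite cos_overlapE.
have b0 : 0 < lam + l by exact: addr_gt0.
have i1 : r / 2 <= \int[mu]_(x in `[0, r]) cos ((lam - l) * x + l * 0).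
  rewrite [X in X <= _](_ : _ = \int[mu]_(x in `[0, r]) 2^-1); last first.
    by rewrite Rintegral_cst_itv ?ltW// subr0 mulrC.
  apply: le_Rintegral => //; [|exact: integrable_cos_affine|].
    by apply: (@integrable_bounded_itv _ _ _ 2^-1) => // x; rewrite ger0_norm// invr_ge0.
  move=> x /=; rewrite in_itv/= => /andP[x0 xr]; apply: cos_ge_half.
  rewrite mulr0 addr0 normrM (ger0_norm x0).
  by apply: le_trans h1; rewrite ler_wpM2l.
have b_neq0 : lam + l != 0 by rewrite gt_eqF.
have := normr_integral_cos_affine_le2 (- (l * 0)) (ltW r0) b_neq0.
rewrite (gtr0_norm b0) ler_norml => /andP[i2 _].
have : 2 / (lam + l) <= r / 8 by rewrite ler_pdivrMr//; nra.
lra.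
Qed.

Lemma continuous_cos_overlap r lam y : continuous (cos_overlap r lam y).
Proof.
move=> l.
have c1 l' : continuous (fun x : R => cos (l' * (x - y)) * cos (lam * x)).
  have -> : (fun x : R => cos (l' * (x - y)) * cos (lam * x)) =
      (fun x => cos (l' * x + - (l' * y)) * cos (lam * x + 0)).
    by apply/funext => x; rewrite mulrBr addr0.
  by move=> x; apply: cvgM; exact: continuous_cos_affine.
have cos1 (x : R) : `|cos x| <= 1 by rewrite ler_norml cos_geN1 cos_le1.
have b1 l' x : `|cos (l' * (x - y)) * cos (lam * x)| <= 1 by rewrite normrM mulr_ile1.
apply: (@continuity_under_integral _ _ _ mu (fun l x => cos (l * (x - y)) * cos (lam * x))
  `[0, r] _ (l - 1) (l + 1) _ _ (fun=> 1)) => //.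
- move=> l' _; apply: (@integrable_bounded_itv _ _ _ 1); last exact: b1.
  exact: continuous_measurable_fun.
- apply: aeW => x _ l' _; apply: cvgM; last exact: cvg_cst.
  have h : continuous (fun z : R => cos (z * (x - y))).
    rewrite (_ : (fun z => _) = (fun z => cos ((x - y) * z + 0))); first exact: continuous_cos_affine.
    by apply/funext => z; rewrite addr0 mulrC.
  exact: h.
- by apply: (@integrable_bounded_itv _ _ _ 1) => // x; rewrite normr1.
- by move=> l' _; apply: aeW => x _; exact: b1.
- by rewrite inE/= in_itv/=; apply/andP; split; lra.
Qed.

Lemma integrable_continuous_itv (f : R -> R) a b c : continuous f ->
  (forall x, a <= x <= b -> `|f x| <= c) -> mu.-integrable `[a, b] (EFin \o f).
Proof.
move=> cf fc; apply: measurable_bounded_integrable => //.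
- exact: lebesgue_measure_itvcc_lty.
- by apply: measurable_funTS; exact: continuous_measurable_fun.
- exists c; split; [exact: num_real|move=> c' cc' x /=; rewrite in_itv/= => xab].
  by rewrite (le_trans (fc _ xab))// ltW.
Qed.

Lemma normr_integral_itv_le (f : R -> R) a b c : a <= b -> continuous f ->
  (forall x, a <= x <= b -> `|f x| <= c) -> `|\int[mu]_(x in `[a, b]) f x| <= c * (b - a).
Proof.
move=> ab cf fc; have fi := integrable_continuous_itv cf fc.
apply: (le_trans (le_normr_Rintegral _ fi)) => //.
rewrite -Rintegral_cst_itv//; apply: le_Rintegral => //.
- exact: integrable_norm.
- by apply: (@integrable_bounded_itv _ _ _ `|c|) => // x.
Qed.

Lemma ge_integral_itv (f : R -> R) a b c M : a <= b -> continuous f ->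
  (forall x, a <= x <= b -> `|f x| <= M) -> (forall x, a <= x <= b -> c <= f x) ->
  c * (b - a) <= \int[mu]_(x in `[a, b]) f x.
Proof.
move=> ab cf fM fc; have fi := integrable_continuous_itv cf fM.
rewrite -Rintegral_cst_itv//; apply: le_Rintegral => //.
- by apply: (@integrable_bounded_itv _ _ _ `|c|) => // x.
Qed.

Lemma ae_translate (c : R) (P : R -> Prop) :
  {ae mu, forall x, P x} -> {ae mu, forall x, P (x - c)}.
Proof.
move=> /(ae_reflect 0)/(ae_reflect c) h; apply: (ae_imp h) => x.
by rewrite sub0r opprB.
Qed.

Lemma integrable_translate (c : R) (F : R -> \bar R) :
  mu.-integrable setT F -> mu.-integrable setT (fun x => F (x - c)%R).
Proof.
move=> /integrableP[mF iF].
have mt : measurable_fun setT (fun x : R => x - c) by exact: measurable_funB.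
apply/integrableP; split; first exact: (measurableT_comp mF mt).
rewrite (@integral_translate _ c (fun y => `|F y|%E))//.
exact: (measurableT_comp (@abse_measurable _ _) mF).
Qed.

End blocks.

(** * The sum of blocks, its Fourier transform, and cosine transforms on short intervals *)

Section block_function.
Context {R : realType}.
Notation mu := (@lebesgue_measure R).
Variables d N L : nat -> R.
Hypothesis d_gt0 : forall k, 0 < d k.
Hypothesis N_gt0 : forall k, 0 < N k.
(** Besides sending [L k] to infinity, this lets a truncation to [-n, n] meet only blocks of index
    at most [n]; hence the sums over [n.+1] indices below. *)
Hypothesis L_gt_nat : forall k, k%:R < L k.
(** The factor 1/2 puts two distinct blocks at distance at least half the start of the farther
    one. *)
Hypothesis L_gap : forall i k, (i < k)%N -> L i + N i <= L k / 2.
Hypothesis d_noninc : forall i k, (i <= k)%N -> d k <= d i.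

Definition block_sum (n : nat) (l : R) : R :=
  \sum_(k < n) d k * \1_(`[L k, L k + N k]) `|l|.

Definition block_fun (l : R) : R := limn (fun n => block_sum n l).

Lemma L_gt0 k : 0 < L k. Proof. by apply: le_lt_trans (L_gt_nat k). Qed.

Lemma L_le i k : (i <= k)%N -> L i <= L k.
Proof.
rewrite leq_eqVlt => /predU1P[->//|ik].
have := L_gap ik; have := N_gt0 i; have := L_gt0 k; lra.
Qed.

Lemma indic_block_eq0 n k (l : R) : `|l| < L n -> (n <= k)%N ->
  \1_(`[L k, L k + N k]) `|l| = 0 :> R.
Proof.
move=> ln nk; rewrite indicE memNset//= in_itv/= => /andP[].
by rewrite leNgt (lt_le_trans ln)// L_le.
Qed.

Lemma block_sum_stable n m (l : R) : `|l| < L n -> (n <= m)%N ->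
  block_sum m l = block_sum n l.
Proof.
move=> ln; elim: m => [|m IH]; first by rewrite leqn0 => /eqP ->.
rewrite leq_eqVlt => /predU1P[->//|]; rewrite ltnS => nm.
by rewrite /block_sum big_ord_recr /= (indic_block_eq0 ln nm) mulr0 addr0; exact: IH.
Qed.

Lemma block_funE n (l : R) : `|l| < L n -> block_fun l = block_sum n l.
Proof.
move=> ln; apply: cvg_lim => //; apply: cvg_near_cst.
by exists n => // m /= nm; exact: block_sum_stable.
Qed.

Lemma lt_L_trunc (l : R) : `|l| < L (Num.truncn `|l|).+1.
Proof. by apply: lt_trans (L_gt_nat _); exact: truncnS_gt. Qed.

Lemma block_inj i k (l : R) : L i <= l <= L i + N i -> L k <= l <= L k + N k -> i = k.
Proof.
have aux a b : (a < b)%N -> L a <= l <= L a + N a -> L b <= l <= L b + N b -> False.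
  move=> ab /andP[_ h1] /andP[h2 _].
  have := L_gap ab; have := L_gt0 b; lra.
move=> hi hk; case: (ltngtP i k) => // ik; exfalso.
  exact: (aux _ _ ik hi hk).
exact: (aux _ _ ik hk hi).
Qed.

Lemma block_fun_on k (l : R) : L k <= `|l| <= L k + N k -> block_fun l = d k.
Proof.
move=> lk; pose n := maxn (Num.truncn `|l|).+1 k.+1.
have ln : `|l| < L n by apply: (lt_le_trans (lt_L_trunc l)); apply: L_le; exact: leq_maxl.
have kn : (k < n)%N by exact: leq_maxr.
rewrite (block_funE ln) /block_sum (bigD1 (Ordinal kn))//= big1 ?addr0.
  by rewrite indicE mem_set ?mulr1//= in_itv.
move=> i ik; rewrite indicE memNset ?mulr0//= in_itv/= => li.
by move/eqP: ik; apply; apply: val_inj; exact: block_inj li lk.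
Qed.

Lemma block_fun_cases (l : R) :
  block_fun l = 0 \/ exists k, L k <= `|l| <= L k + N k.
Proof.
have [[k kP]|nk] := pselect (exists k, L k <= `|l| <= L k + N k); [by right; exists k|left].
rewrite (block_funE (lt_L_trunc l)) /block_sum big1// => i _.
rewrite indicE memNset ?mulr0//= in_itv/= => li; apply: nk; by exists i.
Qed.

Lemma block_fun_ge0 (l : R) : 0 <= block_fun l.
Proof.
case: (block_fun_cases l) => [->//|[k /block_fun_on ->]]; exact: ltW.
Qed.

Lemma block_fun_le (l : R) : block_fun l <= d 0.
Proof.
case: (block_fun_cases l) => [->|[k /block_fun_on ->]]; [exact: ltW|exact: d_noninc].
Qed.

Lemma measurable_indic_normr (a b : R) : measurable_fun setT (fun l : R => \1_(`[a, b]) `|l| : R).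
Proof.
apply: (@measurableT_comp _ _ _ _ _ _ (\1_(`[a, b]) : R -> R)).
  exact: measurable_indic.
exact: normr_measurable.
Qed.

Lemma measurable_block_sum n : measurable_fun setT (block_sum n).
Proof.
apply: measurable_sum => k; apply: measurable_funM => //.
exact: measurable_indic_normr.
Qed.

Lemma measurable_block_fun : measurable_fun setT block_fun.
Proof.
apply: (measurable_fun_cvg (h := block_sum)) => //; first exact: measurable_block_sum.
move=> l _; rewrite (block_funE (lt_L_trunc l)); apply: cvg_near_cst.
by exists (Num.truncn `|l|).+1 => // m /= nm; exact: block_sum_stable (lt_L_trunc l) nm.
Qed.

(** At most one block is active at each point, so the p-th power of the function is at most the sum
    of the p-th powers of its blocks, with integrals 2 d_k^p N_k. *)
Lemma block_fun_Lfun (p A : R) : 1 <= p -> (forall k, d k `^ p * N k <= A / 2 ^+ k) ->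
  block_fun \in Lfun mu p%:E.
Proof.
move=> p1 dNA.
have mf := measurable_block_fun.
pose u (k : nat) (l : R) := (d k `^ p * \1_(`[L k, L k + N k]) `|l|)%:E.
have mind k : measurable_fun setT (fun l : R => (\1_(`[L k, L k + N k]) `|l| : R)%:E).
  by apply/measurable_EFinP; exact: measurable_indic_normr.
have u0 k l : (0 <= u k l)%E by rewrite lee_fin mulr_ge0// powR_ge0.
have mu_ k : measurable_fun setT (u k).
  by apply/measurable_EFinP; apply: measurable_funM => //; exact: measurable_indic_normr.
rewrite inE; apply/andP; split; rewrite inE//= /finite_norm unlock; apply: poweR_lty.
apply: (@le_lt_trans _ _ (\int[mu]_l \sum_(k <oo) u k l)%E).
  apply: ge0_le_integral => //.
  - by move=> l _; rewrite poweR_ge0.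
  - apply/measurable_EFinP.
    apply: (@measurableT_comp _ _ _ _ _ _ (fun x : R => x `^ p)) => //.
    exact: measurableT_comp.
  - exact: measurable_nneseries.
  - move=> l _; rewrite /= ger0_norm ?block_fun_ge0//.
    case: (block_fun_cases l) => [->|[k kl]].
      rewrite powR0; first exact: nneseries_ge0.
      by rewrite gt_eqF// (lt_le_trans ltr01).
    rewrite (block_fun_on kl); apply: le_trans (nneseries_term_le k (u0 ^~ l)).
    by rewrite /u indicE mem_set ?mulr1//= in_itv.
rewrite integral_nneseries//.
apply: (@le_lt_trans _ _ (2 * (2 * A))%:E); last exact: ltry.
apply: nneseries_half_le => k; first exact: integral_ge0.
under eq_integral do rewrite /u EFinM.
rewrite ge0_integralZl_EFin ?powR_ge0//; last exact: mind.
rewrite integral_indic_normr_measure ?L_gt0//; last by rewrite lerDl ltW.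
rewrite -EFinM lee_fin [X in _ * (2 * X)](_ : _ = N k); last by ring.
by rewrite mulrCA -mulrA ler_pM2l//; exact: dNA.
Qed.

(** Right end of block [k] after truncation to [-n, n]. If [n%:R < L k], the truncated block is
    empty and its transform is 0. *)
Definition block_end (k n : nat) : R := Num.min (L k + N k) n%:R.

Definition block_transform (k n : nat) (x : R) : R :=
  \int[mu]_(l in `[L k, block_end k n]) cos (l * x).

(** The transform of the truncation. The factor is [pi^-1] instead of [(2 * pi)^-1] because the
    mirror blocks at [l] and [- l] are folded into one cosine integral. *)
Definition block_kernel (n : nat) (x : R) : R :=
  pi^-1 * \sum_(k < n.+1) d k * block_transform k n x.

Lemma block_fun_truncation n (l : R) :
  (block_fun \* \1_(`[- n%:R, n%:R])) l =
  \sum_(k < n.+1) d k * \1_(`[L k, block_end k n]) `|l|.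
Proof.
rewrite /= indicE.
have [ln|ln] := boolP (l \in `[- n%:R, n%:R]%classic); last first.
  rewrite mulr0 big1// => k _; rewrite indicE memNset ?mulr0//= in_itv/= le_min => /and3P[_ _ h].
  by move/negP: ln; apply; rewrite mem_set//= in_itv/= -ler_norml.
have {}ln : `|l| <= n%:R by move: ln; rewrite inE/= in_itv/= -ler_norml.
have lL : `|l| < L n.+1 by apply: (le_lt_trans ln); apply: lt_trans (L_gt_nat _); rewrite ltr_nat.
rewrite mulr1 (block_funE lL); apply: eq_bigr => k _; congr (_ * _).
rewrite !indicE; congr (nat_of_bool _)%:R.
by apply/idP/idP; rewrite !inE/= !in_itv/= le_min ?ln ?andbT.
Qed.

Lemma fourier_block_truncation n (x : R) :
  fourierL1 (block_fun \* \1_(`[- n%:R, n%:R])) x = Complex (block_kernel n x) 0.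
Proof.
have key (t : R -> R) : continuous t -> (forall y, `|t y| <= 1) ->
    \int[mu]_l ((block_fun \* \1_(`[- n%:R, n%:R])) l * t (l * x)) =
    \sum_(k < n.+1) d k * \int[mu]_(l in `[L k, block_end k n]) (t (l * x) + t (- l * x)).
  move=> ct t1.
  have mt := measurable_trig ct x.
  under eq_Rintegral do rewrite block_fun_truncation mulr_suml.
  have hi k : mu.-integrable setT (EFin \o (fun l => d k * (\1_(`[L k, block_end k n]) `|l| * t (l * x)))).
    apply: (@integrableZl _ _ _ mu setT measurableT (d k) (fun l => (\1_(`[L k, block_end k n]) `|l| * t (l * x))%:E)).
    by apply: integrable_indic_normr_mul => //; exact: L_gt0.
  under eq_Rintegral do under eq_bigr do rewrite -mulrA.
  rewrite (Rintegral_sum n.+1 measurableT hi).2.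
  apply: eq_bigr => k _; rewrite RintegralZl//; last by apply: integrable_indic_normr_mul => //; exact: L_gt0.
  congr (_ * _).
  by rewrite (@integral_indic_normr _ _ _ (fun l => t (l * x)))//; exact: L_gt0.
have bcos (y : R) : `|cos y| <= 1 by rewrite ler_norml cos_geN1 cos_le1.
have bsin (y : R) : `|sin y| <= 1 by rewrite ler_norml sin_geN1 sin_le1.
rewrite fourierL1E; congr Complex.
  rewrite (key _ (@continuous_cos R) bcos) /block_kernel.
  have E k : \int[mu]_(l in `[L k, block_end k n]) (cos (l * x) + cos (- l * x)) =
      2 * block_transform k n x.
    rewrite /block_transform; under eq_Rintegral do rewrite mulNr cosN -mulr2n -mulr_natl.
    rewrite RintegralZl//.
    under [X in _ \o X]eq_fun do rewrite mulrC -[_ * _]addr0.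
    exact: integrable_cos_affine.
  under eq_bigr do rewrite E mulrCA.
  by rewrite -mulr_sumr mulrA [_^-1 * 2]mulrC invfM mulrA divff// mul1r.
rewrite (key _ (@continuous_sin R) bsin) big1 ?mulr0// => k _.
under eq_Rintegral do rewrite mulNr sinN subrr.
by rewrite /Rintegral integral0 mulr0.
Qed.

Lemma block_transform_eq0 k n (x : R) : block_end k n < L k -> block_transform k n x = 0.
Proof.
move=> h; rewrite /block_transform set_itv_ge ?Rintegral_set0//.
by rewrite bnd_simp -ltNge.
Qed.

Lemma block_transformE k n (x : R) : block_transform k n x =
  \int[mu]_(l in `[L k, block_end k n]) cos (x * l + 0).
Proof. by apply: eq_Rintegral => l _; rewrite addr0 mulrC. Qed.

Lemma block_transform_le k n (x : R) : `|block_transform k n x| <= N k.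
Proof.
have [h|h] := leP (L k) (block_end k n); last first.
  by rewrite block_transform_eq0// normr0 ltW.
rewrite block_transformE (le_trans (normr_integral_cos_affine_le _ _ h))//.
by rewrite lerBlDl ge_min lexx.
Qed.

Lemma block_transform_le2 k n (x : R) : `|x * block_transform k n x| <= 2.
Proof.
have [->|x0] := eqVneq x 0; first by rewrite mul0r normr0.
have [h|h] := leP (L k) (block_end k n); last first.
  by rewrite block_transform_eq0// mulr0 normr0.
rewrite normrM mulrC -ler_pdivlMr ?normr_gt0// block_transformE.
exact: normr_integral_cos_affine_le2.
Qed.

(** With B the transform, 5 = 1 + 4 comes from adding B^2 <= N^2 and N^2 (xB)^2 <= 4 N^2. *)
Lemma block_transform_sqr_le k n (x : R) :
  block_transform k n x ^+ 2 <= 5 * (N k ^+ 2 / (1 + N k ^+ 2 * x ^+ 2)).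
Proof.
have den : 0 < 1 + N k ^+ 2 * x ^+ 2 by rewrite ltr_wpDr// mulr_ge0// sqr_ge0.
rewrite mulrA ler_pdivlMr//.
have h1 : block_transform k n x ^+ 2 <= N k ^+ 2.
  by rewrite -[X in X <= _]real_normK ?num_real// lerXn2r ?nnegrE ?block_transform_le// ltW.
have h2 : (x * block_transform k n x) ^+ 2 <= 2 ^+ 2.
  by rewrite -[X in X <= _]real_normK ?num_real// lerXn2r ?nnegrE ?block_transform_le2.
have h3 := ler_wpM2l (sqr_ge0 (N k)) h2.
rewrite exprMn in h3; nra.
Qed.

Variable A : R.
(** In this bound and the next, 4^k is spent as two factors 2^k: one makes the series converge, the
    other yields the tail rate 2^-K or absorbs the weights of [sqr_sum_le]. *)
Hypothesis d_le : forall k, d k <= A / 4 ^+ k.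
Hypothesis dN_le : forall k, d k ^+ 2 * N k <= A / 4 ^+ k.

Definition block_density (k : nat) (x : R) : R :=
  2 ^+ k.+1 * d k ^+ 2 * 5 * (N k ^+ 2 / (1 + N k ^+ 2 * x ^+ 2)).

(** Dominates the squares of all the truncated kernels at once. It is extended-valued because the
    series may diverge at 0. *)
Definition block_majorant (x : R) : \bar R := (\sum_(k <oo) (block_density k x)%:E)%E.

Lemma block_density_ge0 k (x : R) : 0 <= block_density k x.
Proof.
rewrite /block_density; apply: mulr_ge0.
  by rewrite mulr_ge0// mulr_ge0 ?exprn_ge0 ?sqr_ge0// ltW.
by rewrite divr_ge0 ?sqr_ge0// addr_ge0// mulr_ge0// sqr_ge0.
Qed.

Lemma block_majorant_ge0 (x : R) : (0 <= block_majorant x)%E.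
Proof. by apply: nneseries_ge0 => k _ _; rewrite lee_fin block_density_ge0. Qed.

Lemma measurable_block_density k : measurable_fun setT (block_density k).
Proof.
apply: measurable_funM => //; apply: continuous_measurable_fun => x.
have den : 0 < 1 + N k ^+ 2 * x ^+ 2 by rewrite ltr_wpDr// mulr_ge0// sqr_ge0.
apply: cvgM; first exact: cvg_cst.
apply: cvgV; first by rewrite gt_eqF.
apply: cvgD; first exact: cvg_cst.
by apply: cvgM; [exact: cvg_cst|exact: exprn_continuous].
Qed.

Lemma measurable_block_majorant : measurable_fun setT block_majorant.
Proof.
apply: measurable_nneseries => [k x|k]; first by rewrite lee_fin block_density_ge0.
by apply/measurable_EFinP; exact: measurable_block_density.
Qed.

Lemma block_kernel_sqr_le n (x : R) : ((block_kernel n x ^+ 2)%:E <= block_majorant x)%E.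
Proof.
apply: le_trans (nneseries_lim_ge n.+1 _); last first.
  by move=> k _ _; rewrite lee_fin block_density_ge0.
rewrite big_mkord sumEFin lee_fin /block_kernel exprMn.
apply: (@le_trans _ _ ((\sum_(k < n.+1) d k * block_transform k n x) ^+ 2)).
  rewrite ler_piMl ?sqr_ge0// exprn_ile1// ?invr_ge0 ?pi_ge0// invf_le1 ?pi_gt0//.
  by apply: le_trans (pi_ge2 R); rewrite ler1n.
apply: (le_trans (sqr_sum_le (fun k => d k * block_transform k n x) _)).
apply: ler_sum => k _; rewrite /block_density exprMn [leLHS]mulrA -[leRHS]mulrA.
apply: ler_wpM2l; first by rewrite mulr_ge0 ?exprn_ge0// ltW.
exact: block_transform_sqr_le.
Qed.

Lemma integrable_block_majorant : mu.-integrable setT block_majorant.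
Proof.
apply/integrableP; split; first exact: measurable_block_majorant.
under eq_integral do rewrite gee0_abs ?block_majorant_ge0//.
rewrite integral_nneseries//; last 2 first.
- by move=> k; apply/measurable_EFinP; exact: measurable_block_density.
- by move=> k x _; rewrite lee_fin block_density_ge0.
apply: (@le_lt_trans _ _ (2 * (10 * pi * A))%:E); last exact: ltry.
apply: nneseries_half_le => k.
  by apply: integral_ge0 => x _; rewrite lee_fin block_density_ge0.
under eq_integral do rewrite /block_density EFinM.
rewrite ge0_integralZl_EFin//; last 3 first.
- by move=> x _; rewrite lee_fin divr_ge0 ?sqr_ge0// addr_ge0// mulr_ge0// sqr_ge0.
- apply/measurable_EFinP; apply: continuous_measurable_fun => x.
  have den : 0 < 1 + N k ^+ 2 * x ^+ 2 by rewrite ltr_wpDr// mulr_ge0// sqr_ge0.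
  apply: cvgM; first exact: cvg_cst.
  apply: cvgV; first by rewrite gt_eqF.
  apply: cvgD; first exact: cvg_cst.
  by apply: cvgM; [exact: cvg_cst|exact: exprn_continuous].
- by rewrite !mulr_ge0 ?exprn_ge0// ltW.
rewrite integral_cauchy_density// -EFinM lee_fin.
have := dN_le k; rewrite ler_pdivlMr ?exprn_gt0// => h.
rewrite ler_pdivlMr ?exprn_gt0//.
rewrite (_ : 4 = 2 * 2 :> R) ?exprMn in h; last by ring.
rewrite (_ : _ * 2 ^+ k = 10 * pi * (d k ^+ 2 * N k * (2 ^+ k * 2 ^+ k))); last by rewrite exprS; ring.
by rewrite ler_pM2l// mulr_gt0// pi_gt0.
Qed.

Lemma block_kernel_widen n m (x : R) : (n <= m)%N ->
  block_kernel n x = pi^-1 * \sum_(k < m.+1) d k * block_transform k n x.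
Proof.
move=> nm; congr (_ * _).
rewrite (big_ord_widen m.+1 (fun k => d k * block_transform k n x)) ?ltnS//.
rewrite big_mkcond; apply: eq_bigr => k _; case: ifPn => //; rewrite -leqNgt => nk.
rewrite block_transform_eq0 ?mulr0// gt_min; apply/orP; right.
by apply: le_lt_trans (L_gt_nat k); rewrite ler_nat ltnW.
Qed.

(** Blocks of index below [K] lie entirely inside [-n, n] and cancel in the difference. Each later
    block changes by at most d_k times 4/|x|, with d_k <= A / (2^K 2^k); summing the 2^-k doubles
    the constant 4 to 8. *)
Lemma block_kernel_tail K n m (x : R) : x != 0 -> L K <= n%:R -> (n <= m)%N ->
  `|block_kernel m x - block_kernel n x| <= 8 * A / `|x| / 2 ^+ K.
Proof.
move=> x0 LKn nm.
have A0 : 0 <= A by have := le_trans (ltW (d_gt0 0)) (d_le 0); rewrite expr0 divr1.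
have x0' : 0 < `|x| by rewrite normr_gt0.
rewrite (block_kernel_widen _ nm) /block_kernel -mulrBr -sumrB normrM.
apply: (@le_trans _ _ `|\sum_(k < m.+1) (d k * block_transform k m x - d k * block_transform k n x)|).
  rewrite ler_piMl// ger0_norm ?invr_ge0 ?pi_ge0// invf_le1 ?pi_gt0//.
  by apply: le_trans (pi_ge2 R); rewrite ler1n.
apply: (le_trans (ler_norm_sum _ _ _)).
apply: (@le_trans _ _ (\sum_(k < m.+1) 4 * A / `|x| / 2 ^+ K * (2 ^+ k)^-1)); last first.
  rewrite -mulr_sumr.
  rewrite [leRHS](_ : _ = 4 * A / `|x| / 2 ^+ K * 2); last by ring.
  rewrite ler_wpM2l ?sum_half_le// !mulr_ge0// ?invr_ge0 ?exprn_ge0// ltW//.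
apply: ler_sum => k _; rewrite -mulrBr normrM (gtr0_norm (d_gt0 k)).
have [kK|Kk] := ltnP k K.
  rewrite /block_transform (_ : block_end k m = block_end k n) ?subrr ?normr0 ?mulr0.
    by rewrite !divr_ge0 ?exprn_ge0// mulr_ge0.
  have h : L k + N k <= n%:R.
    by have := L_gap kK; have := L_gt0 K; lra.
  rewrite /block_end !min_l//; apply: (le_trans h); by rewrite ler_nat.
have h : `|block_transform k m x - block_transform k n x| <= 4 / `|x|.
  rewrite ler_pdivlMr//; apply: (@le_trans _ _ (`|x * block_transform k m x| + `|x * block_transform k n x|)).
    by rewrite -normrM mulrBl ![_ * x]mulrC; exact: ler_normB.
  have := block_transform_le2 k m x; have := block_transform_le2 k n x; lra.
apply: (le_trans (ler_pM (ltW (d_gt0 k)) (normr_ge0 _) (d_le k) h)).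
rewrite (_ : 4 * A / `|x| / 2 ^+ K / 2 ^+ k = A / (2 ^+ K * 2 ^+ k) * (4 / `|x|)); last first.
  by rewrite invfM; ring.
apply: ler_wpM2r; first by rewrite divr_ge0// ltW.
apply: ler_wpM2l => //; rewrite lef_pV2 ?posrE ?mulr_gt0 ?exprn_gt0//.
rewrite (_ : 4 = 2 * 2 :> R) ?exprMn; last by ring.
by rewrite ler_wpM2r ?exprn_ge0// ler_weXn2l// ler1n.
Qed.

Lemma cvg_block_kernel (x : R) : x != 0 -> cvgn (block_kernel ^~ x).
Proof.
move=> x0; apply/cauchy_cvgP/cauchy_exP => e e0.
have /cvgrPdist_lt /(_ _ e0) [K _ HK] := cvg_geometric_half (8 * A / `|x|).
pose n := (Num.truncn (L K)).+1.
have LKn : L K <= n%:R by apply: ltW; exact: truncnS_gt.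
exists (block_kernel n x); exists n => // m /= nm.
rewrite /ball /= distrC (le_lt_trans (block_kernel_tail x0 LKn nm))//.
have := HK K (leqnn K); rewrite sub0r normrN; exact/le_lt_trans/ler_norm.
Qed.

(* At [x = 0] the limit need not exist. *)
Definition block_limit (x : R) : R := if x == 0 then 0 else limn (block_kernel ^~ x).

Lemma block_limit_cvg (x : R) : x != 0 -> (fun n => block_kernel n x) @ \oo --> block_limit x.
Proof. by move=> x0; rewrite /block_limit (negbTE x0); exact: cvg_block_kernel. Qed.

Lemma block_limit_cvg_ae : {ae mu, forall x, (fun n => block_kernel n x) @ \oo --> block_limit x}.
Proof.
exists [set 0]; split => //; first exact: lebesgue_measure_set1.
move=> x /= nx; apply: contrapT => x0; apply: nx; apply: block_limit_cvg.
exact/eqP.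
Qed.

Lemma block_fun_Lfun2 : block_fun \in Lfun mu 2%:E.
Proof.
apply: (@block_fun_Lfun _ A); first by rewrite ler1n.
move=> k; rewrite powR_mulrn; last exact: ltW.
apply: (le_trans (dN_le k)).
have A0 : 0 <= A by have := le_trans (ltW (d_gt0 0)) (d_le 0); rewrite expr0 divr1.
rewrite ler_wpM2l// lef_pV2 ?posrE ?exprn_gt0// lerXn2r ?nnegrE// ler_nat.
by [].
Qed.

Lemma measurable_block_kernel n : measurable_fun setT (block_kernel n).
Proof.
have bcos (y : R) : `|cos y| <= 1 by rewrite ler_norml cos_geN1 cos_le1.
have := measurable_trig_transform bcos (@continuous_cos R) (integrable_truncation n block_fun_Lfun2).
move=> m; rewrite (_ : block_kernel n = fun x => (2 * pi)^-1 * \int[mu]_l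
    ((block_fun \* \1_(`[- n%:R, n%:R])) l * cos (l * x))).
  by apply: measurable_funM.
by apply/funext => x; have := fourier_block_truncation n x; rewrite fourierL1E => -[].
Qed.

Lemma measurable_block_limit : measurable_fun setT block_limit.
Proof.
pose h (n : nat) (x : R) : R := \1_(~` [set 0 : R]) x * block_kernel n x.
apply: (measurable_fun_cvg (h := h)) => //; rewrite /h.
  move=> n; apply: measurable_funM; last exact: measurable_block_kernel.
  by apply: measurable_indic; exact: measurableC.
move=> x _; have [->|x0] := eqVneq x 0.
  under eq_fun do rewrite indicE memNset ?mul0r//=.
  by rewrite /block_limit eqxx; exact: cvg_cst.
rewrite (_ : (fun n => _) = block_kernel ^~ x); first exact: block_limit_cvg.
by apply/funext => n; rewrite indicE mem_set ?mul1r//=; exact/eqP.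
Qed.

Lemma block_limit_sqr_le (x : R) : ((block_limit x ^+ 2)%:E <= block_majorant x)%E.
Proof.
have [->|x0] := eqVneq x 0.
  by rewrite /block_limit eqxx expr0n /=; exact: block_majorant_ge0.
have c : (fun n => (block_kernel n x ^+ 2)%:E) @ \oo --> (block_limit x ^+ 2)%:E.
  apply: cvg_EFin; first exact: nearW.
  apply: (@cvg_comp _ _ _ (fun n => block_kernel n x) (fun z : R => z ^+ 2) _ (nbhs (block_limit x))).
    exact: block_limit_cvg.
  exact: exprn_continuous.
rewrite -(cvg_lim _ c)//; apply: lime_le; first by apply/cvg_ex; eexists; exact: c.
by apply: nearW => n; exact: block_kernel_sqr_le.
Qed.

(** The function already lies in L^2, so its L^1 summand is taken to be 0; the truncated kernels
    converge in L^2 by dominated convergence. *)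
Lemma is_fourier_block : is_fourier block_fun (fun x => Complex (block_limit x) 0).
Proof.
exists (fun=> 0), block_fun, (fun x => Complex (block_limit x) 0).
have F0 x : fourierL1 (fun=> 0 : R) x = 0.
  rewrite fourierL1E; apply/eqP; rewrite eq_complex /=.
  have I0 (t : R -> R) : \int[mu]_l (0 * t l) = 0.
    by under eq_Rintegral do rewrite mul0r; rewrite /Rintegral integral0.
  by rewrite !I0 mulr0 eqxx.
split.
- by apply/Lfun1_integrable; exact: integrable0.
- exact: block_fun_Lfun2.
- by apply/funext => x /=; rewrite add0r.
- split; first by split; [exact: measurable_block_limit|exact: measurable_cst].
  pose f_ n (x : R) : \bar R := ((block_limit x - block_kernel n x) ^+ 2)%:E.
  under eq_fun do under eq_integral do rewrite fourier_block_truncation cabs_sqrB /= subrr expr0n addr0.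
  rewrite -(integral0 mu setT).
  (* The 4 comes from (a - b)^2 <= 2a^2 + 2b^2, where both squares are below the majorant. *)
  have [|||||_ _ dc] := @dominated_convergence _ _ _ mu setT measurableT f_ (cst 0%E)
     (fun x => 4%:E * block_majorant x)%E; last exact: dc.
  + move=> n; apply/measurable_EFinP; apply: measurable_funX; apply: measurable_funB.
      exact: measurable_block_limit.
    exact: measurable_block_kernel.
  + exact: measurable_cst.
  + apply: (ae_imp block_limit_cvg_ae) => x cx _; rewrite /f_.
    apply: cvg_EFin; first exact: nearW.
    rewrite [X in _ --> X](_ : _ = (block_limit x - block_limit x) ^+ 2); last by rewrite subrr expr0n.
    apply: (@cvg_comp _ _ _ (fun n => block_limit x - block_kernel n x) (fun z : R => z ^+ 2) _
      (nbhs (block_limit x - block_limit x))).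
      by apply: cvgB => //; exact: cvg_cst.
    exact: exprn_continuous.
  + exact: integrableZl integrable_block_majorant.
  + apply: aeW => x n _; rewrite /f_ gee0_abs ?lee_fin ?sqr_ge0//.
    have := block_limit_sqr_le x; have := block_kernel_sqr_le n x.
    case: (block_majorant x) => [v| |]; rewrite ?leeNy_eq// => h1 h2; last first.
      by rewrite gt0_muley ?lte_fin// leey.
    move: h1 h2; rewrite -EFinM !lee_fin => h1 h2.
    have := sqr_ge0 (block_limit x + block_kernel n x); nra.
- by apply/funext => x; rewrite F0 add0r.
Qed.

(** If [j] is the larger of [i] and [k], block [i] disturbs the transform on block [k] by at most 4
    d_i N_i / L_j. The 256 is 4 times the 64 of [off_block_le], and [2 ^+ j] makes the disturbances
    summable. For i = j it also yields 256 N_j <= L_j. *)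
Hypothesis dNL : forall i j, (i <= j)%N -> d i * N i * (256 * 2 ^+ j) <= d j * L j.

Definition cos_pairing (n : nat) (r lam y : R) : R :=
  \int[mu]_(x in `[0, r]) (block_kernel n (x - y) * cos (lam * x)).

Lemma measurable_block_transform k n : measurable_fun setT (block_transform k n).
Proof.
have bcos (y : R) : `|cos y| <= 1 by rewrite ler_norml cos_geN1 cos_le1.
have i1 : mu.-integrable setT (EFin \o (\1_(`[L k, block_end k n]) : R -> R)) by exact: integrable_indic_itv.
have := measurable_trig_transform bcos (@continuous_cos R) i1.
rewrite (_ : (fun x => _) = block_transform k n)//.
apply/funext => x; rewrite /block_transform [RHS]Rintegral_mkcond; apply: eq_Rintegral => l _.
by rewrite patchE indicE; case: (_ \in _); rewrite ?mul1r ?mul0r.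
Qed.

(** Fubini brings the integral over [[0, r]] inside, so that the blocks can be estimated frequency
    by frequency. *)
Lemma cos_pairingE n (r lam y : R) : cos_pairing n r lam y =
  pi^-1 * \sum_(k < n.+1) d k *
    \int[mu]_(l in `[L k, block_end k n]) cos_overlap r lam y l.
Proof.
have cos1 (x : R) : `|cos x| <= 1 by rewrite ler_norml cos_geN1 cos_le1.
have mcos : measurable_fun setT (fun x : R => cos (lam * x)).
  have := @continuous_cos_affine R lam 0; under eq_fun do rewrite addr0.
  exact: continuous_measurable_fun.
pose h k x := pi^-1 * (d k * (block_transform k n (x - y) * cos (lam * x))).
have mh k : measurable_fun setT (fun x : R => block_transform k n (x - y) * cos (lam * x)).
  apply: measurable_funM => //; apply: (measurableT_comp (measurable_block_transform k n)).
  exact: measurable_funB.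
have ih k : mu.-integrable `[0, r] (EFin \o (fun x : R => block_transform k n (x - y) * cos (lam * x))).
  apply: (@integrable_bounded_itv _ _ _ (N k)) => // x.
  by rewrite normrM -[leRHS]mulr1 ler_pM// block_transform_le.
have ih2 k : mu.-integrable `[0, r] (EFin \o (fun x : R => d k * (block_transform k n (x - y) * cos (lam * x)))).
  by apply: (@integrableZl _ _ _ mu _ _ (d k) (EFin \o (fun x : R => block_transform k n (x - y) * cos (lam * x)))).
have ih3 k : mu.-integrable `[0, r] (EFin \o h k).
  by apply: (@integrableZl _ _ _ mu _ _ pi^-1 (EFin \o (fun x : R => d k * (block_transform k n (x - y) * cos (lam * x))))).
rewrite /cos_pairing.
transitivity (\int[mu]_(x in `[0, r]) \sum_(k < n.+1) h k x).
  apply: eq_Rintegral => x _; rewrite /h /block_kernel -mulr_sumr -mulrA mulr_suml.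
  by congr (_ * _); apply: eq_bigr => k _; rewrite mulrA.
rewrite (Rintegral_sum n.+1 _ ih3).2// mulr_sumr; apply: eq_bigr => k _.
rewrite /h RintegralZl// RintegralZl//; congr (_ * (_ * _)).
transitivity (\int[mu]_(x in `[0, r]) \int[mu]_(l in `[L k, block_end k n]) (cos (l * (x - y)) * cos (lam * x))).
  apply: eq_Rintegral => x _; rewrite /block_transform -RintegralZr//.
  under [X in _ \o X]eq_fun do rewrite mulrC -[_ * _]addr0.
  exact: integrable_cos_affine.
have mk : measurable_fun setT (fun z : R * R => cos (z.2 * (z.1 - y)) * cos (lam * z.1)).
  apply: measurable_funM; last by apply: (measurableT_comp mcos).
  apply: (measurableT_comp (continuous_measurable_fun (@continuous_cos R))).
  by apply: measurable_funM => //; exact: measurable_funB.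
by rewrite (@Rfubini_itv _ (fun z : R * R => cos (z.2 * (z.1 - y)) * cos (lam * z.1)) 1)// => z;
  rewrite normrM mulr_ile1.
Qed.

Lemma block_gap i k (lam l : R) : i != k -> L k <= lam <= L k + N k ->
  L i <= l <= L i + N i -> L (maxn i k) / 2 <= `|lam - l|.
Proof.
move=> ik /andP[k1 k2] /andP[i1 i2].
have [lt_ik|lt_ki|e] := ltngtP i k; last by rewrite e eqxx in ik.
  have := L_gap lt_ik; have := ler_norm (lam - l); lra.
have := L_gap lt_ki; rewrite distrC.
have := ler_norm (l - lam); lra.
Qed.

(** The overlap is at most 4 / L_j with j = max(i, k). If i < k, [dNL] applies to the pair directly;
    if i > k, its diagonal case at [i] combines with d_i <= d_k. *)
Lemma off_block_le i k n (r lam y : R) : i != k -> 0 <= r -> L k <= lam <= L k + N k ->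
  `|d i * \int[mu]_(l in `[L i, block_end i n]) cos_overlap r lam y l| <= d k / 64 * (2 ^+ i)^-1.
Proof.
move=> ik r0 lamk.
have pos : 0 <= d k / 64 * (2 ^+ i)^-1 by rewrite mulr_ge0 ?invr_ge0 ?exprn_ge0// divr_ge0// ltW.
have [h|h] := leP (L i) (block_end i n); last first.
  by rewrite set_itv_ge ?Rintegral_set0 ?mulr0 ?normr0// bnd_simp -ltNge.
set j := maxn i k; have Lj := L_gt0 j.
have lam0 : 0 < lam by case/andP: lamk => + _; exact/lt_le_trans/L_gt0.
have bnd l : L i <= l <= block_end i n -> `|cos_overlap r lam y l| <= 4 / L j.
  move=> /andP[l1 l2].
  have l3 : l <= L i + N i by apply: (le_trans l2); rewrite ge_min lexx.
  have l0 : 0 < l by apply: lt_le_trans l1; exact: L_gt0.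
  rewrite (_ : 4 / L j = 2 / (L j / 2)); last by field; rewrite gt_eqF.
  apply: cos_overlap_le2 => //; first by rewrite divr_gt0.
  by apply: block_gap => //; rewrite l1.
have := normr_integral_itv_le h (@continuous_cos_overlap _ r lam y) bnd.
move=> b1; rewrite normrM (gtr0_norm (d_gt0 i)).
have b2 : block_end i n - L i <= N i by rewrite lerBlDl ge_min lexx.
have b3 : `|\int[mu]_(x in `[L i, block_end i n]) cos_overlap r lam y x| <= 4 / L j * N i.
  by apply: (le_trans b1); rewrite ler_wpM2l// divr_ge0// ltW.
apply: (le_trans (ler_wpM2l (ltW (d_gt0 i)) b3)).
have b4 : d i * N i * (256 * 2 ^+ j) <= d k * L j.
  rewrite /j; have [lt_ik|lt_ki|e] := ltngtP i k; last by rewrite e eqxx in ik.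
    by apply: dNL; exact: ltnW.
  apply: (le_trans (dNL (leqnn i))).
  by apply: ler_wpM2r; [exact: ltW (L_gt0 i)|exact/d_noninc/ltnW].
have b5 : (2 : R) ^+ i <= 2 ^+ j by rewrite ler_weXn2l ?ler1n// leq_maxl.
have e2 : (0 : R) < 2 ^+ i by rewrite exprn_gt0.
have dN0 : 0 <= d i * N i by rewrite mulr_ge0 ?ltW.
have b6 : d i * N i * (256 * 2 ^+ i) <= d k * L j.
  apply: le_trans b4; apply: ler_wpM2l; first exact: dN0.
  by apply: ler_wpM2l; [exact: ler0n|exact: b5].
rewrite -[leRHS]mulrA -invfM ler_pdivlMr ?mulr_gt0//.
rewrite (_ : _ * _ = (d i * N i * (256 * 2 ^+ i)) / L j); last by field; rewrite gt_eqF.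
by rewrite ler_pdivrMr.
Qed.

Lemma main_block_split n k (f : nat -> R) : (k <= n)%N ->
  \sum_(i < n.+1) f i = f k + \sum_(i < n.+1 | i != k :> nat) f i.
Proof.
rewrite -ltnS => kn; rewrite (bigD1 (Ordinal kn))//=.
Qed.

Lemma off_blocks_le k n (r lam y : R) : 0 <= r -> L k <= lam <= L k + N k ->
  `|\sum_(i < n.+1 | i != k :> nat) d i * \int[mu]_(l in `[L i, block_end i n]) cos_overlap r lam y l|
  <= d k / 32.
Proof.
move=> r0 lamk; apply: (le_trans (ler_norm_sum _ _ _)).
apply: (@le_trans _ _ (\sum_(i < n.+1 | i != k :> nat) d k / 64 * (2 ^+ i)^-1)).
  by apply: ler_sum => i ik; exact: off_block_le.
apply: (@le_trans _ _ (\sum_(i < n.+1) d k / 64 * (2 ^+ i)^-1)).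
  rewrite big_mkcond; apply: ler_sum => i _; case: ifP => // _.
  by rewrite mulr_ge0 ?invr_ge0 ?exprn_ge0// divr_ge0// ltW.
rewrite -mulr_sumr (_ : d k / 32 = d k / 64 * 2); last by field.
by rewrite ler_wpM2l ?sum_half_le// divr_ge0// ltW.
Qed.

(** For r = 1/N_k each overlap is at most r, so block [k] contributes at most d_k N_k r = d_k,
    whatever the translation [y]; the other blocks add at most d_k / 32. *)
Lemma cos_pairing_le k n (lam y : R) : (k <= n)%N -> L k <= lam <= L k + N k ->
  `|pi * cos_pairing n (N k)^-1 lam y| <= 2 * d k.
Proof.
move=> kn lamk; have r0 : 0 < (N k)^-1 by rewrite invr_gt0.
rewrite cos_pairingE mulrA divff ?mul1r ?gt_eqF ?pi_gt0//.
rewrite (main_block_split (fun i => d i * \int[mu]_(l in `[L i, block_end i n]) cos_overlap (N k)^-1 lam y l) kn).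
have h1 := off_blocks_le n y (ltW r0) lamk.
apply: (le_trans (ler_normD _ _)).
have h2 : `|d k * \int[mu]_(l in `[L k, block_end k n]) cos_overlap (N k)^-1 lam y l| <= d k.
  have [h|h] := leP (L k) (block_end k n); last first.
    by rewrite set_itv_ge ?Rintegral_set0 ?mulr0 ?normr0 ?ltW// bnd_simp -ltNge.
  rewrite normrM (gtr0_norm (d_gt0 k)) ler_piMr ?(ltW (d_gt0 k))//.
  apply: (le_trans (normr_integral_itv_le h (@continuous_cos_overlap _ _ _ _)
    (fun l _ => cos_overlap_le lam y l (ltW r0)))).
  by rewrite mulrC ler_pdivrMr// mul1r lerBlDl ge_min lexx.
have := d_gt0 k; lra.
Qed.

(** Once the truncation contains the whole block [k], all its overlaps at y = 0 are at least r/8 and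
    add up to d_k / 8; the other blocks remove at most d_k / 32. *)
Lemma cos_pairing0_ge k n (lam : R) : (k <= n)%N -> L k + N k <= n%:R ->
  L k <= lam <= L k + N k -> d k / 16 <= pi * cos_pairing n (N k)^-1 lam 0.
Proof.
move=> kn endn lamk; have r0 : 0 < (N k)^-1 by rewrite invr_gt0.
rewrite cos_pairingE mulrA divff ?mul1r ?gt_eqF ?pi_gt0//.
rewrite (main_block_split (fun i => d i * \int[mu]_(l in `[L i, block_end i n]) cos_overlap (N k)^-1 lam 0 l) kn).
have := off_blocks_le n 0 (ltW r0) lamk; rewrite ler_norml => /andP[h1 _].
have L256 : 256 * N k <= L k.
  have := dNL (leqnn k); rewrite -mulrA ler_pM2l// => /(le_trans _); apply.
  rewrite mulrC; apply: ler_wpM2l; first exact: ltW (N_gt0 k).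
  rewrite ler_peMr ?ler0n//; apply: exprn_ege1; by rewrite (ler_nat _ 1 2).
have h2 : d k / 8 <= d k * \int[mu]_(l in `[L k, block_end k n]) cos_overlap (N k)^-1 lam 0 l.
  rewrite ler_pM2l// /block_end min_l//.
  have kk : L k <= L k + N k by rewrite lerDl ltW.
  have := @ge_integral_itv _ (cos_overlap (N k)^-1 lam 0) _ _ ((N k)^-1 / 8) _ kk (@continuous_cos_overlap _ _ _ _)
    (fun l _ => cos_overlap_le lam 0 l (ltW r0)).
  rewrite addrAC subrr add0r mulrAC mulVf ?gt_eqF// mul1r; apply.
  move=> l lk; case/andP: lamk => lam1 lam2; case/andP: lk => l1 l2.
  have Lk := L_gt0 k.
  apply: cos_overlap0_ge => //.
  - exact: lt_le_trans lam1.
  - exact: lt_le_trans l1.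
  - by rewrite ler_pdivrMr// mul1r ler_norml; apply/andP; split; lra.
  - by rewrite ler_pdivlMr//; have := N_gt0 k; lra.
have := d_gt0 k; lra.
Qed.

Definition cos_pairing_limit (r lam y : R) : R :=
  \int[mu]_(x in `[0, r]) (block_limit (x - y) * cos (lam * x)).

Lemma cvg_cos_pairing (r lam y : R) :
  (fun n => cos_pairing n r lam y) @ \oo --> cos_pairing_limit r lam y.
Proof.
have cos1 (x : R) : `|cos x| <= 1 by rewrite ler_norml cos_geN1 cos_le1.
have mcos : measurable_fun setT (fun x : R => cos (lam * x)).
  have := @continuous_cos_affine R lam 0; under eq_fun do rewrite addr0.
  exact: continuous_measurable_fun.
have mt : measurable_fun setT (fun x : R => x - y) by exact: measurable_funB.
(* |a| <= 1 + a^2 turns the majorant of the squares into one of the kernels themselves, integrable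
   on a bounded interval. *)
apply: (@Rdominated_cvg _ `[0, r]%classic _ _ (fun x => 1%:E + block_majorant (x - y))%E) => //.
- move=> n; apply: measurable_funTS; apply: measurable_funM => //.
  exact: (measurableT_comp (measurable_block_kernel n) mt).
- apply: measurable_funTS; apply: measurable_funM => //.
  exact: (measurableT_comp measurable_block_limit mt).
- apply: (ae_imp (ae_translate y block_limit_cvg_ae)) => x cx _.
  by apply: cvgM => //; exact: cvg_cst.
- apply: integrableD => //.
    by apply: (@integrable_bounded_itv _ _ _ 1) => // x; rewrite normr1.
  apply: (integrableS measurableT) => //.
  exact: (integrable_translate y integrable_block_majorant).
- move=> x n _; have := block_kernel_sqr_le n (x - y).
  move=> h; apply: (@le_trans _ _ (1 + block_kernel n (x - y) ^+ 2)%:E); last first.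
    by rewrite EFinD leeD2l.
  rewrite lee_fin normrM; apply: (@le_trans _ _ `|block_kernel n (x - y)|).
    by rewrite ler_piMr.
  rewrite -(@real_normK _ (block_kernel n (x - y))) ?num_real//.
  have := normr_ge0 (block_kernel n (x - y)); nra.
Qed.

Lemma cos_pairing_limit_le k (lam y : R) : L k <= lam <= L k + N k ->
  `|pi * cos_pairing_limit (N k)^-1 lam y| <= 2 * d k.
Proof.
move=> lamk.
have c : (fun n => `|pi * cos_pairing n (N k)^-1 lam y|) @ \oo --> `|pi * cos_pairing_limit (N k)^-1 lam y|.
  by apply: cvg_norm; apply: cvgM; [exact: cvg_cst|exact: cvg_cos_pairing].
rewrite -(cvg_lim _ c)//; apply: limr_le; first by apply/cvg_ex; eexists; exact: c.
by exists k => // n /= kn; exact: cos_pairing_le.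
Qed.

Lemma cos_pairing_limit0_ge k (lam : R) : L k <= lam <= L k + N k ->
  d k / 16 <= pi * cos_pairing_limit (N k)^-1 lam 0.
Proof.
move=> lamk.
have c : (fun n => pi * cos_pairing n (N k)^-1 lam 0) @ \oo --> pi * cos_pairing_limit (N k)^-1 lam 0.
  by apply: cvgM; [exact: cvg_cst|exact: cvg_cos_pairing].
rewrite -(cvg_lim _ c)//; apply: limr_ge; first by apply/cvg_ex; eexists; exact: c.
exists (maxn k (Num.truncn (L k + N k)).+1) => // n /=; rewrite geq_max => /andP[kn en].
apply: cos_pairing0_ge => //; apply: ltW; apply: (lt_le_trans (truncnS_gt _)).
by rewrite ler_nat.
Qed.

End block_function.

(** * The Krein system on a short interval *)
Section krein_solution.
Context {R : realType}.
Notation mu := (@lebesgue_measure R).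

Lemma integrable_patch_L2 (f : R -> R) (a b : R) : measurable_fun `[a, b] f ->
  (\int[mu]_(x in `[a, b]) ((f x) ^+ 2)%:E < +oo)%E ->
  mu.-integrable setT (EFin \o (f \_ `[a, b])).
Proof.
move=> mf f2; rewrite -restrict_EFin; apply/integrable_restrict => //; rewrite setTI.
have i2 : mu.-integrable `[a, b] (EFin \o (fun x => f x ^+ 2)).
  apply/integrableP; split; first by apply/measurable_EFinP; exact: measurable_funX.
  by under eq_integral do rewrite gee0_abs ?lee_fin ?sqr_ge0//.
have i1 : mu.-integrable `[a, b] (EFin \o (fun=> 1 : R)).
  by apply: (@integrable_bounded_itv _ _ _ 1) => // x; rewrite normr1.
apply: (le_integrable _ _ _ (integrableD _ i1 i2)) => //.
  exact/measurable_EFinP.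
move=> x _ /=; rewrite lee_fin [leRHS]ger0_norm; last by rewrite addr_ge0 ?sqr_ge0.
rewrite -(@real_normK _ (f x)) ?num_real//.
have := normr_ge0 (f x); nra.
Qed.

Lemma is_fourier_measurable (f : R -> R) (F : R -> R[i]) : is_fourier f F ->
  cmeasurable_fun setT F.
Proof.
have bcos (y : R) : `|cos y| <= 1 by rewrite ler_norml cos_geN1 cos_le1.
have bsin (y : R) : `|sin y| <= 1 by rewrite ler_norml sin_geN1 sin_le1.
move=> [f1 [f2 [F2 [hf1 hf2 fE [[mRe mIm] L2] ->]]]].
have i1 : mu.-integrable setT (EFin \o f1) by apply/Lfun1_integrable.
have ReD (z u : R[i]) : complex.Re (z + u) = complex.Re z + complex.Re u by case: z u => [? ?] [].
have ImD (z u : R[i]) : complex.Im (z + u) = complex.Im z + complex.Im u by case: z u => [? ?] [].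
split.
  under eq_fun do rewrite ReD fourierL1E.
  apply: measurable_funD => //; apply: measurable_funM => //.
  exact: (measurable_trig_transform bcos (@continuous_cos R) i1).
under eq_fun do rewrite ImD fourierL1E.
apply: measurable_funD => //; apply: measurable_funM => //.
exact: (measurable_trig_transform bsin (@continuous_sin R) i1).
Qed.

Variables (w H0 : R -> R) (r : R).
Hypothesis mH0 : measurable_fun setT H0.
Hypothesis iH0 : mu.-integrable setT (EFin \o (fun x => H0 x ^+ 2)).
Hypothesis mkreinH : cmeasurable_fun setT (kreinH w).
Hypothesis kreinHE : {ae mu, forall x, kreinH w x = Complex (H0 x) 0}.
Hypothesis r_gt0 : 0 < r.

Local Notation D := (`[0, r]%classic : set R).
(** Differences of points of [[0, r]] lie in [-r, r], so on [[0, r]] the operator is convolution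
    with this integrable kernel. *)
Local Notation K := (H0 \_ `[- r, r]).

(** Twice this is the bound 1/64 on the L^1 norm of the resolvent column. It reduces the transform
    bound 2 d_k to d_k / 32, half of the main term d_k / 16. *)
Hypothesis K_small : \int[mu]_x `|K x| <= 128^-1.

Lemma H0_sqr_lty (a b : R) : (\int[mu]_(x in `[a, b]) ((H0 x) ^+ 2)%:E < +oo)%E.
Proof.
have [_] := integrableP _ _ _ iH0; apply: le_lt_trans.
under [leRHS]eq_integral do rewrite gee0_abs ?lee_fin ?sqr_ge0//.
apply: ge0_subset_integral => //.
  by apply/measurable_EFinP; exact: measurable_funX.
by move=> x _; rewrite lee_fin sqr_ge0.
Qed.

Lemma integrable_H0_patch (a b : R) : mu.-integrable setT (EFin \o (H0 \_ `[a, b])).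
Proof.
apply: integrable_patch_L2; [exact: measurable_funTS|exact: H0_sqr_lty].
Qed.

Lemma conv_patchE (u : R -> R) (x : R) : D x ->
  conv K (u \_ D) x = \int[mu]_(y in D) (H0 (x - y) * u y).
Proof.
rewrite /= in_itv/= => /andP[x0 xr].
rewrite [RHS]Rintegral_mkcond; apply: eq_Rintegral => y _; rewrite !patchE.
case: ifPn => yD; case: ifPn => yD'; rewrite ?mulr0//.
exfalso; move: yD'; rewrite inE/= in_itv/= => /andP[y0 yr].
by move/negP: yD; apply; rewrite inE/= in_itv/=; apply/andP; split; lra.
Qed.

(** For each fixed [x] the identity with [H0] holds at [x - y] for almost every [y], so the equality
    is valid at every [x] of the interval. As the kernel is real, real and imaginary parts
    decouple. *)
Lemma kreinHopE (g : R -> R[i]) (x : R) : cmeasurable_fun D g -> D x ->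
  kreinHop w r g x = Complex (conv K ((fun y => complex.Re (g y)) \_ D) x)
                             (conv K ((fun y => complex.Im (g y)) \_ D) x).
Proof.
move=> [mg1 mg2] Dx; rewrite !conv_patchE//.
have mt : measurable_fun setT (fun y : R => x - y) by exact: measurable_subl.
have mH : measurable_fun D (fun y : R => H0 (x - y)).
  by apply: measurable_funTS; exact: (measurableT_comp mH0 mt).
have mR : measurable_fun D (fun y : R => complex.Re (kreinH w (x - y))).
  by apply: measurable_funTS; exact: (measurableT_comp mkreinH.1 mt).
have mI : measurable_fun D (fun y : R => complex.Im (kreinH w (x - y))).
  by apply: measurable_funTS; exact: (measurableT_comp mkreinH.2 mt).
have ReM (z u : R[i]) : complex.Re (z * u) = complex.Re z * complex.Re u - complex.Im z * complex.Im u.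
  by case: z u => [? ?] [].
have ImM (z u : R[i]) : complex.Im (z * u) = complex.Re z * complex.Im u + complex.Im z * complex.Re u.
  by case: z u => [? ?] [].
have ae := ae_reflect x kreinHE.
rewrite /kreinHop /cintegral; congr Complex; rewrite /Rintegral; congr fine.
  apply: ae_eq_integral => //.
  - apply/measurable_EFinP; under [X in measurable_fun _ X]eq_fun do rewrite ReM.
    by apply: measurable_funB; apply: measurable_funM.
  - by apply/measurable_EFinP; exact: measurable_funM.
  - by apply: (ae_imp ae) => y -> _; rewrite ReM /= mul0r subr0.
apply: ae_eq_integral => //.
- apply/measurable_EFinP; under [X in measurable_fun _ X]eq_fun do rewrite ImM.
  by apply: measurable_funD; apply: measurable_funM.
- by apply/measurable_EFinP; exact: measurable_funM.
- by apply: (ae_imp ae) => y -> _; rewrite ImM /= mul0r addr0.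
Qed.

(** |ab| <= a^2 + b^2, integrated. It supplies the uniform bound on the first convolution from which
    the Neumann iteration starts. *)
Lemma integrable_L2_mul (u v : R -> R) (x : R) :
  measurable_fun setT u -> mu.-integrable setT (EFin \o (fun y => u y ^+ 2)) ->
  measurable_fun setT v -> mu.-integrable setT (EFin \o (fun y => v y ^+ 2)) ->
  mu.-integrable setT (EFin \o (fun y => u (x - y) * v y)) /\
  `|\int[mu]_y (u (x - y) * v y)| <= \int[mu]_y (u y ^+ 2) + \int[mu]_y (v y ^+ 2).
Proof.
move=> mu_ iu mv iv.
have mux : measurable_fun setT (fun y : R => u (x - y)).
  by apply: (measurableT_comp mu_); exact: measurable_subl.
have iux : mu.-integrable setT (EFin \o (fun y => u (x - y) ^+ 2)) := integrable_reflect x iu.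
have isum := integrableD measurableT iux iv.
have bnd (y : R) : `|u (x - y) * v y| <= u (x - y) ^+ 2 + v y ^+ 2.
  rewrite ler_norml; apply/andP; split.
    by have := sqr_ge0 (u (x - y) + v y); have := sqr_ge0 (u (x - y) - v y); nra.
  by have := sqr_ge0 (u (x - y) + v y); have := sqr_ge0 (u (x - y) - v y); nra.
have iuv : mu.-integrable setT (EFin \o (fun y => u (x - y) * v y)).
  apply: (le_integrable _ _ _ isum) => //; first by apply/measurable_EFinP; exact: measurable_funM.
  by move=> y _ /=; rewrite lee_fin [leRHS]ger0_norm ?addr_ge0 ?sqr_ge0.
split=> //; apply: (le_trans (le_normr_Rintegral _ iuv)) => //.
rewrite -(@Rintegral_reflect _ x (fun y => u y ^+ 2)); last exact: measurable_funX.
rewrite -RintegralD//; apply: le_Rintegral => //.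
exact: integrable_norm.
Qed.

Lemma patch_sqr (f : R -> R) (E : set R) : (fun x => (f \_ E) x ^+ 2) = (fun x => f x ^+ 2) \_ E.
Proof. by apply/funext => x; rewrite !patchE; case: ifPn => //; rewrite expr0n. Qed.

Lemma integrable_H0_patch_sqr (a b : R) :
  mu.-integrable setT (EFin \o (fun x => (H0 \_ `[a, b]) x ^+ 2)).
Proof.
rewrite patch_sqr -restrict_EFin; apply/integrable_restrict => //; rewrite setTI.
exact: (integrableS measurableT).
Qed.

(** Needed for the [xget] in [kreinInv] to pick a solution instead of its default. The witness is
    [H0] minus a bounded correction, hence in L^2 of the bounded interval. *)
Lemma kreinInv_exists : exists g : R -> R[i], cL2 D g /\
  {ae mu, forall x, D x -> g x + kreinHop w r g x = kreinH w (x - 0)}.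
Proof.
have mHD (a b : R) : measurable_fun setT (H0 \_ `[a, b]) by exact: integrable_measurable (integrable_H0_patch a b).
have L2 x := integrable_L2_mul x (mHD (- r) r) (integrable_H0_patch_sqr (- r) r) (mHD 0 r) (integrable_H0_patch_sqr 0 r).
have [||||||b [mb bM bE]] := @exists_neumann_correction _ K H0 D _ _ _ _ _ _ _ (fun x => (L2 x).2) => //.
- exact: lebesgue_measure_itvcc_lty.
- exact: integrable_H0_patch.
- by apply: (le_trans K_small); rewrite lef_pV2 ?posrE// ler_nat.
- exact: integrable_H0_patch.
- by move=> x; exact: (L2 x).1.
set M := 2 * _ in bM.
pose g x := Complex (H0 x - b x) 0.
have mg : cmeasurable_fun D g.
  split; last exact: measurable_cst.
  by apply: measurable_funTS; exact: measurable_funB.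
exists g; split; first split => //.
  apply: (@le_lt_trans _ _ (\int[mu]_(x in D) (2%:E * ((H0 x) ^+ 2)%:E + (2 * M ^+ 2)%:E))%E).
    apply: ge0_le_integral => //.
    - by move=> x _; rewrite lee_fin sqr_ge0.
    - apply/measurable_EFinP; under [X in measurable_fun _ X]eq_fun do rewrite cabs_sqr /= expr0n addr0.
      by apply: measurable_funTS; apply: measurable_funX; exact: measurable_funB.
    - apply: emeasurable_funD => //; apply/measurable_EFinP.
      by apply: measurable_funTS; apply: measurable_funM => //; exact: measurable_funX.
    - move=> x _; rewrite -EFinM -EFinD lee_fin cabs_sqr /= expr0n addr0.
      have : b x ^+ 2 <= M ^+ 2 by have := bM x; rewrite ler_norml => /andP[]; nra.
      have := sqr_ge0 (H0 x + b x); nra.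
  have i1 : mu.-integrable D (EFin \o (fun x => 2 * H0 x ^+ 2)).
    by apply: (@integrableZl _ _ _ mu _ _ 2 (EFin \o (fun x => H0 x ^+ 2))) => //; exact: (integrableS measurableT).
  have i2 : mu.-integrable D (EFin \o (fun=> 2 * M ^+ 2)).
    by apply: (@integrable_bounded_itv _ _ _ `|2 * M ^+ 2|) => // x.
  exact: integrable_lty (integrableD _ i1 i2).
apply: (ae_imp kreinHE) => x Hx Dx.
rewrite kreinHopE// subr0 Hx /g /=.
rewrite (_ : (fun y => H0 y - b y) = (fun y => complex.Re (g y)))// in bE.
rewrite bE /conv.
rewrite (_ : (fun y => _ * _) = fun=> 0); last first.
  by apply/funext => y; rewrite [X in _ * X]patchE; case: ifPn => _; exact: mulr0.
rewrite /Rintegral integral0; apply/eqP; rewrite eq_complex /= addr0 eqxx andbT.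
by apply/eqP; ring.
Qed.

Local Notation gam := (kreinInv w r (fun x => kreinH w (x - 0))).
Local Notation gamR := (fun x => complex.Re (gam x)).
Local Notation gamI := (fun x => complex.Im (gam x)).

Lemma kreinInvP : cL2 D gam /\
  {ae mu, forall x, D x -> gam x + kreinHop w r gam x = kreinH w (x - 0)}.
Proof.
exact: (@xgetPex _ (fun=> 0 : R[i]) [set g | cL2 D g /\
  {ae mu, forall x, D x -> g x + kreinHop w r g x = kreinH w (x - 0)}] kreinInv_exists).
Qed.

Lemma integrable_gamR : mu.-integrable setT (EFin \o (gamR \_ D)).
Proof.
have [[[mR mI] g2] _] := kreinInvP.
apply: integrable_patch_L2 => //; apply: le_lt_trans g2.
apply: ge0_le_integral => //.
- by move=> x _; rewrite lee_fin sqr_ge0.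
- by apply/measurable_EFinP; exact: measurable_funX.
- apply/measurable_EFinP; under [X in measurable_fun _ X]eq_fun do rewrite cabs_sqr.
  by apply: measurable_funD; exact: measurable_funX.
- by move=> x _; rewrite lee_fin cabs_sqr lerDl sqr_ge0.
Qed.

Lemma integrable_gamI : mu.-integrable setT (EFin \o (gamI \_ D)).
Proof.
have [[[mR mI] g2] _] := kreinInvP.
apply: integrable_patch_L2 => //; apply: le_lt_trans g2.
apply: ge0_le_integral => //.
- by move=> x _; rewrite lee_fin sqr_ge0.
- by apply/measurable_EFinP; exact: measurable_funX.
- apply/measurable_EFinP; under [X in measurable_fun _ X]eq_fun do rewrite cabs_sqr.
  by apply: measurable_funD; exact: measurable_funX.
- by move=> x _; rewrite lee_fin cabs_sqr lerDr sqr_ge0.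
Qed.

Lemma gam_equations : {ae mu, forall x, D x ->
  gamR x + conv K (gamR \_ D) x = H0 x /\ gamI x + conv K (gamI \_ D) x = 0}.
Proof.
have [[mg g2] eqg] := kreinInvP.
apply: (ae_imp (ae_and eqg kreinHE)) => x [eqx Hx] Dx.
have := eqx Dx; rewrite kreinHopE// subr0 Hx; case: (gam x) => a b /= [].
by move=> -> ->.
Qed.

Lemma K_small_half : \int[mu]_x `|K x| <= 2^-1.
Proof. by apply: (le_trans K_small); rewrite lef_pV2 ?posrE// ler_nat. Qed.

Lemma integral_gamR_le : \int[mu]_x `|(gamR \_ D) x| <= 64^-1.
Proof.
have h := @integral_equation_bound _ K H0 D gamR _ (integrable_H0_patch _ _) K_small_half
  (integrable_H0_patch _ _) integrable_gamR.
apply: (le_trans (h _ _)) => //.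
  by apply: (ae_imp gam_equations) => x e Dx; case: (e Dx).
have : \int[mu]_x `|(H0 \_ D) x| <= \int[mu]_x `|K x|.
  apply: le_Rintegral => //; [|exact: integrable_norm (integrable_H0_patch _ _)|].
    exact: integrable_norm (integrable_H0_patch _ _).
  move=> x _; rewrite !patchE; case: ifPn => xD.
    rewrite mem_set//=; move: xD; rewrite inE/= !in_itv/= => /andP[x0 ->]; rewrite andbT.
    by have := r_gt0; lra.
  by rewrite normr0; case: ifPn.
move=> /le_trans/(_ K_small); lra.
Qed.

(** [H] is real, so the imaginary part solves the homogeneous equation, and
    [integral_equation_bound] with [h = 0] makes its L^1 norm vanish. *)
Lemma gamI_eq0 : {ae mu, forall x, (gamI \_ D) x = 0}.
Proof.
have h := @integral_equation_bound _ K (fun=> 0) D gamI _ (integrable_H0_patch _ _) K_small_half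
  _ integrable_gamI.
have z : ((fun=> 0 : R) \_ D) = fun=> 0 by apply/funext => x; rewrite patchE; case: ifPn.
have {}h : \int[mu]_x `|(gamI \_ D) x| <= 0.
  apply: (le_trans (h _ _ _)) => //.
  - by rewrite z; exact: integrable0.
  - by apply: (ae_imp gam_equations) => x e Dx; case: (e Dx).
  rewrite z (_ : (fun x => `|0|) = fun=> 0); last by apply/funext => x; rewrite normr0.
  by rewrite /Rintegral integral0 mulr0.
have iI := integrable_norm integrable_gamI.
have : (\int[mu]_x `|((gamI \_ D) x)%:E| = 0)%E.
  apply/eqP; rewrite eq_le integral_ge0// andbT.
  by have := h; rewrite -lee_fin Rintegral_EFin.
move/ae_eq_integral_abs => /(_ measurableT (measurable_int _ integrable_gamI)) a.
by apply: (ae_imp a) => x /(_ I) /= [].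
Qed.

(** Substituting s = r - t, the difference is -e^(i lam r) times the integral of Gamma_r(s, 0) e^(-i
    lam s). Its modulus is at least that of the real part of this integral, which is the cosine
    transform because the column is real almost everywhere. *)
Lemma cos_transform_le_cabs (lam : R) :
  `|\int[mu]_(x in D) (gamR x * cos (lam * x))| <= cabs (kreinP w r lam - expi (lam * r)).
Proof.
rewrite /kreinP r_gt0.
set Z := cintegral _ _.
have mdl : cabs (expi (lam * r) - Z - expi (lam * r)) = cabs Z.
  by rewrite addrAC subrr add0r; case: Z => a b; rewrite /cabs /= !sqrrN.
rewrite mdl {mdl}.
pose G1 := gamR \_ D; pose G2 := gamI \_ D.
have iG1 : mu.-integrable setT (EFin \o G1) := integrable_gamR.
have mG1 : measurable_fun setT G1 := integrable_measurable iG1.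
have mG2 : measurable_fun setT G2 := integrable_measurable integrable_gamI.
have mt : measurable_fun setT (fun t : R => r - t) by exact: measurable_subl.
have mG1t : measurable_fun setT (fun t : R => G1 (r - t)) := measurableT_comp mG1 mt.
have mG2t : measurable_fun setT (fun t : R => G2 (r - t)) := measurableT_comp mG2 mt.
have Drefl t : (r - t \in D) = (t \in D).
  by apply/idP/idP; rewrite !inE/= !in_itv/= => /andP[? ?]; apply/andP; split; lra.
have aeG2 := ae_reflect r gamI_eq0.
have bcos (y : R) : `|cos y| <= 1 by rewrite ler_norml cos_geN1 cos_le1.
have bsin (y : R) : `|sin y| <= 1 by rewrite ler_norml sin_geN1 sin_le1.
have mcos : measurable_fun setT (fun t : R => cos (lam * t)).
  by apply: (measurableT_comp (continuous_measurable_fun (@continuous_cos R))).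
have msin : measurable_fun setT (fun t : R => sin (lam * t)).
  by apply: (measurableT_comp (continuous_measurable_fun (@continuous_sin R))).
have ReZ : complex.Re Z = \int[mu]_t (G1 (r - t) * cos (lam * t)).
  rewrite /Z /cintegral /= Rintegral_mkcond /Rintegral; congr fine.
  rewrite (_ : (fun x => _) = (fun t => (G1 (r - t) * cos (lam * t) - G2 (r - t) * sin (lam * t))%:E)); last first.
    apply/funext => t; congr (_%:E); rewrite /G1 /G2 !patchE Drefl.
    case: ifPn => tD; last by rewrite (_ : point = 0 :> R)// !mul0r subr0.
    by rewrite /kreinGamma; case: (kreinInv w r _ _) => a b /=.
  apply: ae_eq_integral => //.
  - by apply/measurable_EFinP; apply: measurable_funB; apply: measurable_funM.
  - by apply/measurable_EFinP; apply: measurable_funM.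
  - by apply: (ae_imp aeG2) => t G20 _; rewrite /G2 G20 mul0r subr0.
have ImZ : complex.Im Z = \int[mu]_t (G1 (r - t) * sin (lam * t)).
  rewrite /Z /cintegral /= Rintegral_mkcond /Rintegral; congr fine.
  rewrite (_ : (fun x => _) = (fun t => (G1 (r - t) * sin (lam * t) + G2 (r - t) * cos (lam * t))%:E)); last first.
    apply/funext => t; congr (_%:E); rewrite /G1 /G2 !patchE Drefl.
    case: ifPn => tD; last by rewrite (_ : point = 0 :> R)// !mul0r addr0.
    by rewrite /kreinGamma; case: (kreinInv w r _ _) => a b /=; rewrite addrC.
  apply: ae_eq_integral => //.
  - by apply/measurable_EFinP; apply: measurable_funD; apply: measurable_funM.
  - by apply/measurable_EFinP; apply: measurable_funM.
  - by apply: (ae_imp aeG2) => t G20 _; rewrite /G2 G20 mul0r addr0.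
have i1 : mu.-integrable setT (EFin \o (fun t => G1 (r - t) * cos (lam * t))).
  by apply: (integrable_mul_bounded (M := 1)) => //; exact: (integrable_reflect r iG1).
have i2 : mu.-integrable setT (EFin \o (fun t => G1 (r - t) * sin (lam * t))).
  by apply: (integrable_mul_bounded (M := 1)) => //; exact: (integrable_reflect r iG1).
have rot : \int[mu]_(x in D) (gamR x * cos (lam * x)) =
    cos (lam * r) * complex.Re Z + sin (lam * r) * complex.Im Z.
  transitivity (\int[mu]_x (G1 x * cos (lam * x))).
    rewrite Rintegral_mkcond; apply: eq_Rintegral => x _; rewrite /G1 !patchE.
    by case: ifPn => // _; rewrite mul0r.
  rewrite -(@Rintegral_reflect _ r (fun x => G1 x * cos (lam * x))); last exact: measurable_funM.
  rewrite ReZ ImZ -!RintegralZl// -RintegralD//; last 2 first.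
  - exact: (@integrableZl _ _ _ mu _ measurableT (cos (lam * r)) _ i1).
  - exact: (@integrableZl _ _ _ mu _ measurableT (sin (lam * r)) _ i2).
  by apply: eq_Rintegral => t _; rewrite mulrBr cosB; ring.
rewrite rot -(ler_pXn2r (n := 2))// ?nnegrE//; last by case: Z {ReZ ImZ rot} => a b; exact: sqrtr_ge0.
rewrite cabs_sqr real_normK ?num_real//.
move: (complex.Re Z) (complex.Im Z) => a b.
have := cos2Dsin2 (lam * r).
move: (cos _) (sin _) => c s cs.
(* Lagrange's identity: (ca + sb)^2 + (sa - cb)^2 = (c^2 + s^2)(a^2 + b^2). *)
have := sqr_ge0 (s * a - c * b).
have -> : a ^+ 2 + b ^+ 2 = (c ^+ 2 + s ^+ 2) * (a ^+ 2 + b ^+ 2) by rewrite cs mul1r.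
nra.
Qed.

(** The equation for the column is integrated against the cosine. By Fubini the convolution term
    becomes the column integrated against cosine transforms of translates of [H0]; it is at most [B]
    times the L^1 norm of the column, so it inherits the smallness of [B]. *)
Lemma cos_transform_ge (lam B : R) :
  (forall y, D y -> `|\int[mu]_(x in D) (H0 (x - y) * cos (lam * x))| <= B) ->
  \int[mu]_(x in D) (H0 (x - 0) * cos (lam * x)) - B / 64 <=
  \int[mu]_(x in D) (gamR x * cos (lam * x)).
Proof.
move=> HB.
have B0 : 0 <= B.
  by apply: le_trans (HB 0 _) => //=; rewrite in_itv/= lexx ltW.
pose G := gamR \_ D.
have iG : mu.-integrable setT (EFin \o G) := integrable_gamR.
have iK : mu.-integrable setT (EFin \o K) := integrable_H0_patch _ _.
have iC := integrable_conv iK iG.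
have bcos (y : R) : `|cos y| <= 1 by rewrite ler_norml cos_geN1 cos_le1.
have mcos : measurable_fun setT (fun t : R => cos (lam * t)).
  by apply: (measurableT_comp (continuous_measurable_fun (@continuous_cos R))).
pose ch := (fun x => cos (lam * x)) \_ D.
have mch : measurable_fun setT ch by exact: patch_measurable.
have bch x : `|ch x| <= 1 by exact: normr_patch_le.
have E1 : \int[mu]_(x in D) (gamR x * cos (lam * x)) =
    \int[mu]_x ((H0 \_ D) x * ch x - conv K G x * ch x).
  rewrite Rintegral_mkcond /Rintegral; congr fine.
  have mH : measurable_fun setT (H0 \_ D) := integrable_measurable (integrable_H0_patch _ _).
  apply: ae_eq_integral => //.
  - apply/measurable_EFinP; rewrite (_ : _ \_ D = fun x => G x * ch x).
      by apply: measurable_funM => //; exact: integrable_measurable iG.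
    by apply/funext => x; rewrite /G /ch !patchE; case: ifPn => // _; rewrite mul0r.
  - apply/measurable_EFinP; apply: measurable_funB; apply: measurable_funM => //.
    exact: integrable_measurable iC.
  - apply: (ae_imp gam_equations) => x e _; congr (_%:E); rewrite /ch !patchE.
    case: ifPn => [/set_mem xD|_]; last by rewrite !mulr0 subrr.
    by rewrite -mulrBl; congr (_ * _); rewrite -(e xD).1 addrK.
have E2 : \int[mu]_(x in D) (H0 (x - 0) * cos (lam * x)) = \int[mu]_x ((H0 \_ D) x * ch x).
  rewrite Rintegral_mkcond; apply: eq_Rintegral => x _; rewrite /ch !patchE subr0.
  by case: ifPn => // _; rewrite mul0r.
have iH := integrable_mul_bounded (integrable_H0_patch 0 r) mch bch.
have iCc := integrable_mul_bounded iC mch bch.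
rewrite E1 E2 RintegralB// lerD2l lerN2.
apply: (le_trans (ler_norm _)).
pose F z := K (z.1 - z.2) * G z.2 * ch z.1.
have iF : (mu \x mu)%E.-integrable setT (EFin \o F).
  apply: (le_integrable _ _ _ (conv_prod_integrable iK iG)) => //.
    apply/measurable_EFinP; apply: measurable_funM.
      by apply: measurable_conv_prod; exact: integrable_measurable.
    by apply: (measurableT_comp mch).
  by move=> z _ /=; rewrite lee_fin /F normrM ler_piMr.
(* The inner integrand of [conv] is integrable only for almost every [x], and only there can the
   factor [ch x] be moved inside. *)
have -> : \int[mu]_x (conv K G x * ch x) = \int[mu]_x \int[mu]_y F (x, y).
  rewrite /Rintegral; congr fine; apply: ae_eq_integral => //.
  - exact: measurable_int iCc.
  - apply/measurable_EFinP; apply: (measurableT_comp (fine_measurable measurableT)).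
    exact: measurable_fubini_F iF.
  - apply: (ae_imp (ae_integrable1 (conv_prod_integrable iK iG))) => x ix _.
    by congr (_%:E); rewrite /F /= -[RHS]/(Rintegral _ _ _) RintegralZr.
rewrite Rfubini//.
pose I y := \int[mu]_x F (x, y).
have mI : measurable_fun setT I.
  by apply: (measurableT_comp (fine_measurable measurableT)); exact: measurable_fubini_G iF.
have IB y : `|I y| <= B * `|G y|.
  have [yD|yD] := pselect (D y); last first.
    have G0 : G y = 0 by rewrite /G patchE memNset.
    rewrite G0 normr0 mulr0 /I /F /= G0.
    rewrite (_ : (fun x => _) = fun=> 0); first by rewrite /Rintegral integral0 normr0.
    by apply/funext => x; rewrite mulr0 mul0r.
  have -> : I y = G y * \int[mu]_(x in D) (H0 (x - y) * cos (lam * x)).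
    rewrite -RintegralZl//; last first.
      apply: (le_integrable _ _ _ (integrableS measurableT _ _ (integrable_translate y (integrable_H0_patch (- r) r)))) => //.
        apply/measurable_EFinP; apply: measurable_funTS; apply: measurable_funM => //.
        by apply: (measurableT_comp mH0); exact: measurable_funB.
      move=> x; rewrite /= in_itv/= => /andP[x0 xr]; rewrite lee_fin normrM patchE.
      move: yD; rewrite /= in_itv/= => /andP[y0 yr].
      rewrite mem_set; first by rewrite ler_piMr.
      by rewrite /= in_itv/=; apply/andP; split; lra.
    rewrite /I [RHS]Rintegral_mkcond; apply: eq_Rintegral => x _; rewrite /F /ch /= [in RHS]patchE.
    rewrite [X in _ * X](patchE).
    case: ifPn => [xD|_]; last by rewrite mulr0.
    rewrite patchE mem_set; first by ring.
    move: yD xD; rewrite inE/= !in_itv/= => /andP[y0 yr] /andP[x0 xr].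
    by apply/andP; split; lra.
  by rewrite normrM mulrC ler_wpM2r//; exact: HB.
have iBG : mu.-integrable setT (EFin \o (fun y => B * `|G y|)).
  exact: (@integrableZl _ _ _ mu _ measurableT B _ (integrable_norm iG)).
have iI : mu.-integrable setT (EFin \o I).
  apply: (le_integrable _ _ _ iBG) => //; first exact/measurable_EFinP.
  by move=> y _ /=; rewrite lee_fin [leRHS]ger0_norm// mulr_ge0.
apply: (le_trans (le_normr_Rintegral _ iI)) => //.
apply: (@le_trans _ _ (\int[mu]_y (B * `|G y|))).
  by apply: le_Rintegral => //; exact: integrable_norm.
rewrite RintegralZl//; last exact: integrable_norm.
by rewrite ler_wpM2l//; exact: integral_gamR_le.
Qed.

End krein_solution.

(** * L^1 norms on short intervals, and the A_2 constant *)

Section krein_weight.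
Context {R : realType}.
Notation mu := (@lebesgue_measure R).

(* Unlike [ge0_le_integral], no measurability is required. *)
Lemma ge0_le_integralT (f g : R -> \bar R) : (forall x, 0 <= f x)%E ->
  (forall x, f x <= g x)%E -> (\int[mu]_x f x <= \int[mu]_x g x)%E.
Proof.
move=> f0 fg; rewrite !ge0_integralTE//; last by move=> x; exact: le_trans (fg x).
apply: le_ereal_sup => _ [h hf <-]; exists h => // x; exact: le_trans (hf x) (fg x).
Qed.

(** Integrate |f| <= tau/2 + f^2/(2 tau) over [-r, r]: the first term gives tau r, at most e/2 by
    the choice of [rho], and the second at most S/(2 tau). *)
Lemma integral_patch_small (f : R -> R) (e : R) : measurable_fun setT f ->
  mu.-integrable setT (EFin \o (fun x => f x ^+ 2)) -> 0 < e ->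
  exists2 rho, 0 < rho & forall r : R, 0 < r <= rho -> \int[mu]_x `|(f \_ `[- r, r]) x| <= e.
Proof.
move=> mf if2 e0.
pose S := \int[mu]_x (f x ^+ 2).
have S0 : 0 <= S by apply: Rintegral_ge0 => x _; exact: sqr_ge0.
(* Large enough for S/(2 tau) <= e/2; the added 1 keeps it positive when S = 0. *)
pose tau := S / e + 1.
have tau0 : 0 < tau by rewrite ltr_wpDl// divr_ge0// ltW.
exists (e / (2 * tau)); first by rewrite divr_gt0// mulr_gt0.
move=> r /andP[r0 rr].
have i1 : mu.-integrable setT (EFin \o (fun x => tau / 2 * \1_(`[- r, r]) x)).
  have := @integrable_indic_itv R (- r) r true false.
  exact: (@integrableZl _ _ _ mu _ measurableT (tau / 2)).
have i2 : mu.-integrable setT (EFin \o (fun x => (2 * tau)^-1 * f x ^+ 2)).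
  exact: (@integrableZl _ _ _ mu _ measurableT (2 * tau)^-1 _ if2).
have bnd (x : R) : `|(f \_ `[- r, r]) x| <= tau / 2 * \1_(`[- r, r]) x + (2 * tau)^-1 * f x ^+ 2.
  rewrite patchE indicE; case: ifPn => _; last first.
    by rewrite normr0 mulr0 add0r mulr_ge0 ?sqr_ge0// invr_ge0 mulr_ge0// ltW.
  rewrite mulr1 -(@real_normK _ (f x)) ?num_real//.
  have -> : tau / 2 + (2 * tau)^-1 * `|f x| ^+ 2 = (tau ^+ 2 + `|f x| ^+ 2) / (2 * tau).
    by field; rewrite gt_eqF.
  rewrite ler_pdivlMr ?mulr_gt0//; have := sqr_ge0 (`|f x| - tau); lra.
have ip : mu.-integrable setT (EFin \o (f \_ `[- r, r])).
  apply: (le_integrable _ _ _ (integrableD measurableT i1 i2)) => //.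
    by apply/measurable_EFinP; exact: patch_measurable.
  move=> x _ /=; rewrite lee_fin; apply: (le_trans (bnd x)); exact: ler_norm.
apply: (@le_trans _ _ (\int[mu]_x (tau / 2 * \1_(`[- r, r]) x + (2 * tau)^-1 * f x ^+ 2))).
  apply: le_Rintegral => //; first exact: integrable_norm.
  exact: (integrableD measurableT i1 i2).
rewrite RintegralD// RintegralZl//; last exact: integrable_indic_itv.
rewrite RintegralZl// -/S.
have -> : \int[mu]_x (\1_(`[- r, r]) x) = 2 * r.
  rewrite /Rintegral integral_indic//= setIT lebesgue_measure_itv/= lte_fin gtrN//.
  by rewrite opprK -EFinD /=; ring.
have h1 : tau / 2 * (2 * r) <= e / 2.
  move: rr; rewrite ler_pdivlMr ?mulr_gt0// => rr; lra.
have h2 : (2 * tau)^-1 * S <= e / 2.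
  rewrite mulrC ler_pdivrMr ?mulr_gt0//.
  have : S / e <= tau by rewrite /tau lerDl.
  rewrite ler_pdivrMr// => h; nra.
lra.
Qed.

(** On every interval [w] averages to at most [C], and its inverse, being at most 1, to at most
    1. *)
Lemma A2_const_le (w : R -> R) (C : R) : measurable_fun setT w ->
  (forall x, 1 <= w x <= C) -> (A2_const w <= C%:E)%E.
Proof.
move=> mw w1; apply: ge_ereal_sup => _ [a [b [ab ->]]].
have C0 : 0 <= C by case/andP: (w1 0) => h1 h2; apply: le_trans h2; apply: le_trans h1.
have ba0 : 0 < b - a by rewrite subr_gt0.
have w0 x : 0 < w x by case/andP: (w1 x) => h _; exact: lt_le_trans h.
have avg (f : R -> R) (c : R) : measurable_fun setT f -> (forall x, 0 <= f x <= c) ->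
    (0 <= average `[a, b] (fun x => (f x)%:E) <= c%:E)%E.
  move=> mf fc; rewrite /average lebesgue_measure_itv/= lte_fin ab -EFinB inver gt_eqF//.
  have f0 : (0 <= \int[mu]_(x in `[a, b]) (f x)%:E)%E.
    by apply: integral_ge0 => x _; rewrite lee_fin; case/andP: (fc x).
  rewrite mule_ge0//= ?lee_fin ?invr_ge0 ?(ltW ba0)//.
  have h : (\int[mu]_(x in `[a, b]) (f x)%:E <= (c * (b - a))%:E)%E.
    apply: (@le_trans _ _ (\int[mu]_(x in `[a, b]) (c%:E))%E).
      apply: ge0_le_integral => //.
      - by move=> x _; rewrite lee_fin; case/andP: (fc x).
      - by apply/measurable_EFinP; exact: measurable_funTS.
      - by move=> x _; rewrite lee_fin; case/andP: (fc x).
    by rewrite integral_cst//= lebesgue_measure_itv/= lte_fin ab -EFinB -EFinM.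
  apply: (@le_trans _ _ ((b - a)^-1%:E * (c * (b - a))%:E)%E).
    by apply: lee_wpmul2l => //; rewrite lee_fin invr_ge0 ltW.
  by rewrite -EFinM lee_fin mulrCA mulVf ?gt_eqF// mulr1.
have /andP[h1 h2] := avg w C mw (fun x => introT andP (conj (ltW (w0 x)) (andP (w1 x)).2)).
have mwi : measurable_fun setT (fun x => (w x)^-1).
  apply: (@measurable_comp _ _ _ _ _ _ [set t : R | 0 < t]) => //.
  - by rewrite -set_itvoy.
  - by move=> _ [x _ <-]; exact: w0.
  - rewrite -set_itvoy; apply: open_continuous_measurable_fun; first exact: interval_open.
    by move=> x; rewrite inE/= in_itv/= andbT => x0; apply: inv_continuous; rewrite gt_eqF.
have wi x : 0 <= (w x)^-1 <= 1.
  by rewrite invr_ge0 (ltW (w0 x))/= invf_le1//; case/andP: (w1 x).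
have /andP[h3 h4] := avg _ 1 mwi wi.
have -> : (fun x => ((w x)%:E)^-1%E) = (fun x => ((w x)^-1)%:E).
  by apply/funext => x; rewrite inver gt_eqF.
by rewrite -[leRHS]mule1; exact: lee_pmul.
Qed.

End krein_weight.

(** * The weight *)
Section dyadic_blocks.
Context {R : realType}.
Variables (p2 delta : R).
Hypotheses (hp2 : 1 < p2 <= 2) (hdelta : 0 < delta).

(** With quadratic exponents any gain proportional to k^2 eventually beats losses linear in k, so
    one weight serves every p < p2. The largest height, at k = 0, is [delta]. *)
Definition dyadic_height (k : nat) : R := delta * 2 `^ (- k%:R ^+ 2).
(** Chosen so that d_k^p2 N_k = delta^p2 2^(-3k), which is summable. *)
Definition dyadic_width (k : nat) : R := 2 `^ (p2 * k%:R ^+ 2 - 3 * k%:R).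
(** The term 8 + k matches the factor 256 * 2^k of the interaction bound. Of 2k^2, one half offsets
    the height 2^(-k^2), the other covers d_i N_i <= delta 2^(k^2) for i <= k. *)
Definition dyadic_start (k : nat) : R := 2 `^ (8 + k%:R + 2 * k%:R ^+ 2).

Local Notation d := dyadic_height.
Local Notation N := dyadic_width.
Local Notation L := dyadic_start.

Lemma le_pow2 (a b : R) : a <= b -> 2 `^ a <= 2 `^ b :> R.
Proof. by move=> ab; rewrite ler_powR// ler1n. Qed.

Lemma pow2_nat (m k : nat) : ((2 ^ m)%:R : R) ^+ k = 2 `^ (m%:R * k%:R).
Proof. by rewrite powRrM powR_mulrn ?powR_ge0// powR_mulrn// natrX. Qed.

Lemma pow2D (a b : R) : 2 `^ (a + b) = 2 `^ a * 2 `^ b :> R.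
Proof. by rewrite powRD// pnatr_eq0 implybT. Qed.

Lemma pow2_natE (m : nat) : 2 `^ m%:R = 2 ^+ m :> R.
Proof. by rewrite powR_mulrn. Qed.

Lemma natr_ge1_lt (i k : nat) : (i < k)%N -> (i%:R + 1 : R) <= k%:R.
Proof. by move=> ik; rewrite natr1 ler_nat. Qed.

Lemma dyadic_height_gt0 k : 0 < d k.
Proof. by rewrite mulr_gt0// powR_gt0. Qed.

Lemma dyadic_width_gt0 k : 0 < N k.
Proof. exact: powR_gt0. Qed.

Lemma dyadic_start_gt_nat k : k%:R < L k.
Proof.
apply: (@lt_le_trans _ _ (2 `^ k%:R)).
  by rewrite pow2_natE -natrX ltr_nat ltn_expl.
by apply: le_pow2; have := sqr_ge0 (k%:R : R); lra.
Qed.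

Lemma dyadic_gap i k : (i < k)%N -> L i + N i <= L k / 2.
Proof.
move=> ik; have ik1 := natr_ge1_lt ik.
have i0 : (0 : R) <= i%:R by [].
have h1 : N i <= L i.
  apply: le_pow2; case/andP: hp2 => _ h2.
  have := sqr_ge0 (i%:R : R); nra.
have h2 : 4 * L i <= L k.
  rewrite (_ : 4 = 2 `^ 2%:R); last by rewrite pow2_natE; ring.
  rewrite -pow2D; apply: le_pow2; nra.
lra.
Qed.

Lemma dyadic_height_noninc i k : (i <= k)%N -> d k <= d i.
Proof.
move=> ik; have ik1 : (i%:R : R) <= k%:R by rewrite ler_nat.
have i0 : (0 : R) <= i%:R by [].
rewrite ler_wpM2l ?(ltW hdelta)//; apply: le_pow2; nra.
Qed.

(** k^2 >= 2k - 1 gives the constant 2 delta; the summand delta^2 serves [dyadic_mass_le], which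
    shares the constant. *)
Lemma dyadic_height_le k : d k <= (2 * delta + delta ^+ 2) / 4 ^+ k.
Proof.
rewrite (pow2_nat 2 k) -powRN.
have h : 2 `^ (- k%:R ^+ 2) <= 2 * 2 `^ (- (2 * k%:R)) :> R.
  rewrite -{2}(@powRr1 _ (2 : R))// -pow2D; apply: le_pow2.
  by have := sqr_ge0 (k%:R - 1 : R); nra.
have := @powR_gt0 R 2 (- (2 * k%:R)) (ltr0Sn _ _) => h0.
apply: (@le_trans _ _ (2 * delta * 2 `^ (- (2 * k%:R)))).
  by rewrite mulrAC mulrC ler_wpM2l ?(ltW hdelta)// mulrC.
by rewrite ler_wpM2r ?(ltW h0)// lerDl sqr_ge0.
Qed.

Lemma dyadic_mass_le k : d k ^+ 2 * N k <= (2 * delta + delta ^+ 2) / 4 ^+ k.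
Proof.
rewrite (pow2_nat 2 k) -powRN /d /N exprMn -(@powR_mulrn _ (2 `^ _)) ?powR_ge0// -powRrM -mulrA -pow2D.
have h : 2 `^ (- k%:R ^+ 2 * 2%:R + (p2 * k%:R ^+ 2 - 3 * k%:R)) <= 2 `^ (- (2 * k%:R)) :> R.
  apply: le_pow2; case/andP: hp2 => _ h2.
  by have := sqr_ge0 (k%:R : R); have : (0 : R) <= k%:R by []; nra.
have := @powR_gt0 R 2 (- (2 * k%:R)) (ltr0Sn _ _) => h0.
apply: ler_pM => //; rewrite ?sqr_ge0 ?powR_ge0// lerDr; by rewrite mulr_ge0// ltW.
Qed.

Lemma dyadic_interaction i j : (i <= j)%N -> d i * N i * (256 * 2 ^+ j) <= d j * L j.
Proof.
move=> ij; have ij1 : (i%:R : R) <= j%:R by rewrite ler_nat.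
have i0 : (0 : R) <= i%:R by [].
rewrite (_ : 256 * 2 ^+ j = 2 `^ (8%:R + j%:R) :> R); last first.
  by rewrite pow2D !pow2_natE; congr (_ * _); ring.
rewrite /d /N /L -!mulrA -!pow2D ler_wpM2l ?(ltW hdelta)//; apply: le_pow2.
case/andP: hp2 => _ h2.
have := sqr_ge0 (i%:R : R); nra.
Qed.

Lemma dyadic_Lp_mass k : d k `^ p2 * N k <= delta `^ p2 / 2 ^+ k.
Proof.
rewrite /d /N powRM ?powR_ge0 ?(ltW hdelta)// -powRrM -mulrA -pow2D ler_wpM2l ?powR_ge0//.
rewrite -pow2_natE -powRN; apply: le_pow2.
by have : (0 : R) <= k%:R by []; nra.
Qed.

(** With eta = p2/p - 1, the right side is delta 2^(eta k^2 - 3k/p). The threshold gives eta k^2 >=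
    4k: three of these k pay for 3k/p, the fourth leaves 2^k >= k. *)
Lemma dyadic_norm_ge p k : 1 <= p < p2 -> 4 / (p2 / p - 1) <= k%:R ->
  delta * k%:R <= d k * N k `^ p^-1.
Proof.
move=> /andP[p1 pp2].
have p0 : 0 < p by exact: lt_le_trans p1.
have eta0 : 0 < p2 / p - 1 by rewrite subr_gt0 ltr_pdivlMr ?mul1r.
rewrite ler_pdivrMr// => hk.
have k0 : (0 : R) <= k%:R by [].
rewrite /d /N -powRrM -mulrA -pow2D ler_wpM2l ?(ltW hdelta)//.
apply: (@le_trans _ _ (2 `^ k%:R)).
  by rewrite pow2_natE -natrX ler_nat ltnW// ltn_expl.
apply: le_pow2.
have ip1 : p^-1 <= 1 by rewrite invf_le1.
nra.
Qed.

(** As p2 > 1, the exponent is at least k^2 - 3k, which reaches k at k = 4. *)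
Lemma dyadic_width_ge k : (4 <= k)%N -> k%:R <= N k.
Proof.
rewrite -(ler_nat R) => k4.
apply: (@le_trans _ _ (2 `^ k%:R)).
  by rewrite pow2_natE -natrX ler_nat ltnW// ltn_expl.
apply: le_pow2; case/andP: hp2 => p1 _.
by have := sqr_ge0 (k%:R : R); nra.
Qed.

End dyadic_blocks.

(** * Lower bounds for the solution and for its weighted norm *)

Section block_weight.
Context {R : realType}.
Notation mu := (@lebesgue_measure R).
Variables d N L : nat -> R.
Hypotheses (d_gt0 : forall k, 0 < d k) (N_gt0 : forall k, 0 < N k).
Hypothesis L_gt_nat : forall k, k%:R < L k.
Hypothesis L_gap : forall i k, (i < k)%N -> L i + N i <= L k / 2.
Hypothesis d_noninc : forall i k, (i <= k)%N -> d k <= d i.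
Variable A : R.
Hypothesis d_le : forall k, d k <= A / 4 ^+ k.
Hypothesis dN_le : forall k, d k ^+ 2 * N k <= A / 4 ^+ k.
Hypothesis dNL : forall i j, (i <= j)%N -> d i * N i * (256 * 2 ^+ j) <= d j * L j.

Definition block_weight (l : R) : R := 1 + block_fun d N L l.

Lemma block_weight_sub1 : (fun l => block_weight l - 1) = block_fun d N L.
Proof. by apply/funext => l; rewrite /block_weight addrC addKr. Qed.

Lemma is_fourier_kreinH : is_fourier (block_fun d N L) (kreinH block_weight).
Proof.
rewrite /kreinH /fourier block_weight_sub1.
exact: (xgetPex (fun=> 0) (ex_intro _ _ (is_fourier_block d_gt0 N_gt0 L_gt_nat L_gap d_le dN_le))).
Qed.

Lemma kreinH_ae : {ae mu, forall x, kreinH block_weight x = Complex (block_limit d N L x) 0}.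
Proof.
apply: (fourier_ae is_fourier_kreinH).
  apply: (ae_imp (block_limit_cvg_ae d_gt0 L_gt_nat L_gap d_le)) => x.
  by apply: cvg_trans; apply: near_eq_cvg; apply: nearW => n; rewrite fourier_block_truncation.
by move=> n x; rewrite fourier_block_truncation.
Qed.

Lemma integrable_block_limit_sqr :
  mu.-integrable setT (EFin \o (fun x => block_limit d N L x ^+ 2)).
Proof.
have mG := measurable_block_limit d_gt0 N_gt0 L_gt_nat L_gap d_le dN_le.
apply: (le_integrable _ _ _ (integrable_block_majorant d_gt0 N_gt0 dN_le)) => //.
  by apply/measurable_EFinP; exact: measurable_funX.
move=> x _ /=; rewrite ger0_norm ?sqr_ge0// gee0_abs ?block_majorant_ge0//.
exact: (block_limit_sqr_le d_gt0 N_gt0 L_gt_nat L_gap d_le).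
Qed.

(** The constant is 1/(16 pi) from the main term minus (2/pi)/64 from the correction. [rho] precedes
    [k] because the smallness concerns only the kernel near 0. *)
Lemma kreinP_block_weight_ge : exists2 rho, 0 < rho & forall k (lam : R),
  (N k)^-1 <= rho -> L k <= lam <= L k + N k ->
  d k / (32 * pi) <= cabs (kreinP block_weight (N k)^-1 lam - expi (lam * (N k)^-1)).
Proof.
have mG := measurable_block_limit d_gt0 N_gt0 L_gt_nat L_gap d_le dN_le.
have iG := integrable_block_limit_sqr.
have e0 : 0 < 128^-1 :> R by [].
have [rho rho0 small] := integral_patch_small mG iG e0.
exists rho => // k lam kr hlam.
have r0 : 0 < (N k)^-1 by rewrite invr_gt0.
have mH := is_fourier_measurable is_fourier_kreinH.
have sm : \int[mu]_x `|(block_limit d N L \_ `[- (N k)^-1, (N k)^-1]) x| <= 128^-1.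
  by apply: small; rewrite r0.
have pi0 := pi_gt0 R.
have le_pairing (y : R) : `[0, (N k)^-1]%classic y ->
    `|cos_pairing_limit d N L (N k)^-1 lam y| <= 2 * d k / pi.
  move=> _; have := cos_pairing_limit_le d_gt0 N_gt0 L_gt_nat L_gap d_noninc d_le dN_le dNL y hlam.
  by rewrite normrM (gtr0_norm pi0) ler_pdivlMr// mulrC.
apply: le_trans (cos_transform_le_cabs mG iG mH kreinH_ae r0 sm lam).
apply: le_trans (ler_norm _).
apply: le_trans (cos_transform_ge mG iG mH kreinH_ae r0 sm le_pairing).
have := cos_pairing_limit0_ge d_gt0 N_gt0 L_gt_nat L_gap d_noninc d_le dN_le dNL hlam.
rewrite -[\int[_]_(_ in _) _]/(cos_pairing_limit d N L (N k)^-1 lam 0) [pi * _]mulrC -ler_pdivrMr//.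
suff -> : d k / (32 * pi) = d k / 16 / pi - 2 * d k / pi / 64 by lra.
by move: pi (lt0r_neq0 pi0) => q q0; field.
Qed.

(** The weight is at least 1, so the norm dominates the unweighted one over [a, b]. With [f]
    arbitrary, the comparison goes through [ge0_le_integralT], and the measurability of [kreinP] in
    the spectral variable does not come up. *)
Lemma wLnorm_block_weight_ge (f : R -> R[i]) (p c a b : R) : 0 < p -> 0 <= c -> a < b ->
  (forall lam, a <= lam <= b -> c <= cabs (f lam)) ->
  ((c * (b - a) `^ p^-1)%:E <= wLnorm block_weight p f)%E.
Proof.
move=> p0 c0 ab cf; have ba : 0 < b - a by rewrite subr_gt0.
have w1 x : 1 <= block_weight x by rewrite lerDl block_fun_ge0.
have -> : c * (b - a) `^ p^-1 = (c `^ p * (b - a)) `^ p^-1.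
  by rewrite powRM ?powR_ge0 ?(ltW ba)// -powRrM divff ?gt_eqF// powRr1.
rewrite -poweR_EFin; apply: gt0_ler_poweR; rewrite ?invr_ge0 ?(ltW p0)//.
- by rewrite in_itv/= leey lee_fin mulr_ge0 ?powR_ge0// ltW.
- rewrite in_itv/= leey andbT integral_ge0// => x _.
  by rewrite lee_fin mulr_ge0 ?powR_ge0// (le_trans ler01).
have -> : (c `^ p * (b - a))%:E = (\int[mu]_x (c `^ p * \1_(`[a, b]) x)%:E)%E.
  under eq_integral do rewrite EFinM.
  rewrite ge0_integralZl_EFin ?powR_ge0//; last by apply/measurable_EFinP.
  by rewrite integral_indic//= setIT lebesgue_measure_itv/= lte_fin ab -EFinB -EFinM.
apply: ge0_le_integralT => x; first by rewrite lee_fin mulr_ge0 ?powR_ge0.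
rewrite lee_fin indicE; case: (boolP (x \in _)) => [|_].
  rewrite inE/= in_itv/= => /cf h; rewrite mulr1 -[leLHS]mulr1 ler_pM ?powR_ge0//.
  by apply: ge0_ler_powR; rewrite ?nnegrE ?(ltW p0)// (le_trans c0).
by rewrite mulr0 mulr_ge0 ?powR_ge0// (le_trans ler01).
Qed.

End block_weight.

Lemma exists_nat_ge {R : realType} (a b c : R) :
  exists2 k, (4 <= k)%N & [/\ a <= k%:R, b <= k%:R & c <= k%:R].
Proof.
have tr (x : R) : x <= (Num.truncn x).+1%:R by apply/ltW; exact: truncnS_gt.
exists ((Num.truncn a).+1 + (Num.truncn b).+1 + (Num.truncn c).+1 + 4)%N; first exact: leq_addl.
have := tr a; have := tr b; have := tr c; rewrite !natrD.
have h (x : R) : 0 <= (Num.truncn x).+1%:R :> R by [].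
have := h a; have := h b; have := h c => ha hb hc ta tb tc.
by split; lra.
Qed.

Theorem mainTheorem4 (R : realType) (p2 : R) (hp2 : 1 < p2 <= 2)
    (delta : R) (hdelta : 0 < delta) :
  exists w : R -> R,
    [/\ weight w,
        (fun x => w x - 1) \in Lfun (@lebesgue_measure R) p2%:E,
        (A2_const w <= (1 + delta)%:E)%E
      & forall p : R, 1 <= p < p2 ->
          ereal_sup [set wLnorm w p
                       (fun lambda => kreinP w r lambda - expi (lambda * r))
                    | r in [set r : R | 0 <= r]] = +oo%E].
Proof.
pose d := @dyadic_height R delta.
pose N := @dyadic_width R p2.
pose L := @dyadic_start R.
have d_gt0 : forall k, 0 < d k by exact: dyadic_height_gt0.
have N_gt0 : forall k, 0 < N k by exact: dyadic_width_gt0.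
have L_gt_nat : forall k, k%:R < L k by exact: dyadic_start_gt_nat.
have L_gap : forall i k, (i < k)%N -> L i + N i <= L k / 2 by move=> i k; exact: dyadic_gap.
have d_noninc : forall i k, (i <= k)%N -> d k <= d i by move=> i k; exact: dyadic_height_noninc.
have d_le : forall k, d k <= (2 * delta + delta ^+ 2) / 4 ^+ k by exact: dyadic_height_le.
have dN_le : forall k, d k ^+ 2 * N k <= (2 * delta + delta ^+ 2) / 4 ^+ k.
  exact: dyadic_mass_le.
have dNL : forall i j, (i <= j)%N -> d i * N i * (256 * 2 ^+ j) <= d j * L j.
  by move=> i j; exact: dyadic_interaction.
pose w := block_weight d N L.
have w1 x : 1 <= w x by rewrite lerDl block_fun_ge0.
have mw : measurable_fun setT w.
  by apply: measurable_funD => //; exact: measurable_block_fun.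
exists w; split.
- by split=> // x; exact: le_trans (w1 x).
- rewrite block_weight_sub1; apply: (block_fun_Lfun d_gt0 N_gt0 L_gt_nat L_gap) => //.
    by case/andP: hp2 => /ltW.
  exact: dyadic_Lp_mass.
- apply: A2_const_le => // x; rewrite w1/= lerD2l.
  apply: le_trans (block_fun_le d_gt0 N_gt0 L_gt_nat L_gap d_noninc x) _.
  by rewrite /d /dyadic_height expr0n oppr0 powRr0 mulr1.
move=> p pp; have /andP[p1 pp2] := pp; have p0 : 0 < p by exact: lt_le_trans p1.
have pi0 : 0 < 32 * pi :> R by rewrite mulr_gt0// pi_gt0.
have [rho rho0 large] := kreinP_block_weight_ge d_gt0 N_gt0 L_gt_nat L_gap d_noninc d_le dN_le dNL.
apply/eqyP => M M0.
(* The three thresholds make the interval shorter than [rho], the growth [delta * k%:R] of the block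
   norm available, and that growth larger than [32 * pi * M]. *)
have [k k4 [k1 k2 k3]] := exists_nat_ge rho^-1 (4 / (p2 / p - 1)) (32 * pi * M / delta).
have rhoN : (N k)^-1 <= rho.
  by rewrite -[rho]invrK lef_pV2 ?posrE ?invr_gt0//; apply: (le_trans k1); exact: dyadic_width_ge.
apply: le_trans (ereal_sup_ubound _); last by exists (N k)^-1 => //=; rewrite invr_ge0 ltW.
apply: le_trans (wLnorm_block_weight_ge d_gt0 N_gt0 L_gt_nat L_gap p0 _ _ (fun lam hlam => large k lam rhoN hlam)).
- rewrite lee_fin addrAC subrr add0r mulrAC ler_pdivlMr// mulrC.
  apply: le_trans (dyadic_norm_ge hdelta pp k2).
  by rewrite [delta * _]mulrC -ler_pdivrMr.
- by rewrite divr_ge0// ltW.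
- by rewrite ltrDl.
Qed.
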